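(* Assume that the nonlocal interaction kernel $\omega_\delta$ satisfies $\int_0^\delta \frac{\omega_\delta(h)}{h}\,dh<\infty$. Then any weak solution $u$ of the nonlocal model $$\frac{\partial u}{\partial t}+\int_0^\delta \frac{g(u,\tau_h u)-g(\tau_{-h}u,u)}{h}\,\omega_\delta(h)\,dh=0\quad\text{in }\mathbb{R}\times(0,T),\qquad u(x,0)=u_0(x)$$ is an entropy solution of it. In particular, weak solutions are unique (two weak solutions with the same initial datum $u_0$ coincide almost everywhere).
   Context: Fix $T>0$, $\delta>0$ and $u_0\in L^\infty(\mathbb{R})$. Notation: $\tau_{\pm h}u(x,t)=u(x\pm h,t)$, $a\vee b=\max(a,b)$, $a\wedge b=\min(a,b)$. Kernel: $\omega_\delta:\mathbb{R}\to\mathbb{R}$ is integrable with $\omega_\delta\ge 0$, $\operatorname{supp}\omega_\delta\subseteq[0,\delta]$ and $\int_0^\delta\omega_\delta(h)\,dh=1$. Flux: $g:\mathbb{R}\times\mathbb{R}\to\mathbb{R}$ is consistent with a flux $f$, i.e. $g(u,u)=f(u)$; monotone, i.e. $\partial_1 g\ge 0$ and $\partial_2 g\le 0$ (nondecreasing in the first and nonincreasing in the second argument); and Lipschitz continuous, i.e. $|g(u_1,v_1)-g(u_2,v_2)|\le C(|u_1-u_2|+|v_1-v_2|)$ for all real $u_1,u_2,v_1,v_2$. Weak solution: $u\in L^\infty(\mathbb{R}\times(0,T))$ such that for all $\phi\in C_c^\infty(\mathbb{R}\times[0,T))$ $$\int_0^T\!\!\int_{\mathbb{R}}u\,\frac{\partial\phi}{\partial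 t}\,dx\,dt+\int_{\mathbb{R}}u_0(x)\phi(x,0)\,dx+\int_0^T\!\!\int_{\mathbb{R}}\int_0^\delta\frac{\tau_h\phi-\phi}{h}\,g(u,\tau_hu)\,\omega_\delta(h)\,dh\,dx\,dt=0.$$ Entropy solution: $u\in L^\infty(\mathbb{R}\times(0,T))$ such that for all $c\in\mathbb{R}$ and all nonnegative $\phi\in C_c^\infty(\mathbb{R}\times[0,T))$ $$\int_0^T\!\!\int_{\mathbb{R}}|u-c|\frac{\partial\phi}{\partial t}\,dx\,dt+\int_{\mathbb{R}}|u_0(x)-c|\phi(x,0)\,dx+\int_0^T\!\!\int_{\mathbb{R}}\int_0^\delta\frac{\tau_h\phi-\phi}{h}\,q(u,\tau_hu;c)\,\omega_\delta(h)\,dh\,dx\,dt\ge 0,$$ where $q(a,b;c)=g(a\vee c,b\vee c)-g(a\wedge c,b\wedge c)$. *)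

(* Defs.v *)
From HB Require Import structures.
From mathcomp Require Import all_boot all_order all_algebra.
From mathcomp Require Import all_classical all_reals all_analysis.

Set Implicit Arguments.
Unset Strict Implicit.
Unset Printing Implicit Defensive.
Import Order.TTheory GRing.Theory Num.Theory.
Import numFieldNormedType.Exports.

Local Open Scope classical_set_scope.
Local Open Scope ring_scope.

Section Defs.
Context {R : realType}.

(* A function of space and time is a function of the pair (x, t). *)
Implicit Types (u phi : R * R -> R) (w f : R -> R) (g : R -> R -> R).

Definition leb : {measure set (measurableTypeR R) -> \bar R} :=
  @lebesgue_measure R.

Definition leb2 :
    {measure set (measurableTypeR R * measurableTypeR R)%type -> \bar R} :=
  (@lebesgue_measure R \x @lebesgue_measure R)%E.

Definition strip (T : R) : set (R * R) := [set z | 0 < z.2 < T].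

Definition Linfty f : Prop := f \in Lfun leb +oo%E.

(* The values outside the strip are irrelevant: u is extended by 0. *)
Definition Linfty_strip (T : R) u : Prop :=
  (u \_ (strip T)) \in Lfun leb2 +oo%E.

Definition tau (h : R) u : R * R -> R := fun z => u (z.1 + h, z.2).

Definition dx phi : R * R -> R := fun z => derive1 (fun y => phi (y, z.2)) z.1.
Definition dt phi : R * R -> R := fun z => derive1 (fun s => phi (z.1, s)) z.2.

Definition partials (s : seq bool) phi : R * R -> R :=
  foldr (fun b : bool => if b then dt else dx) phi s.

(* [derive1] is total, so existence of the derivatives is stated separately. *)
Definition smooth phi : Prop :=
  forall s : seq bool,
    [/\ continuous (partials s phi),
        forall x t : R, derivable (fun y => partials s phi (y, t)) x 1
      & forall x t : R, derivable (fun r => partials s phi (x, r)) t 1].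

Definition closed_support phi : set (R * R) := closure [set z | phi z != 0].

(* C_c^oo(R x [0, T)), its elements being represented as restrictions to
   R x [0, T) of functions in C_c^oo(R x (-oo, T)). *)
Definition test_function (T : R) phi : Prop :=
  [/\ smooth phi, compact (closed_support phi)
    & closed_support phi `<=` [set z | z.2 < T]].

Definition is_kernel (delta : R) w : Prop :=
  [/\ leb.-integrable setT (EFin \o w),
      forall h, 0 <= w h,
      closure [set h | w h != 0] `<=` `[0, delta]
    & (\int[leb]_(h in `[0, delta]) w h) = 1].

Definition consistent_flux f g : Prop := forall a, g a a = f a.

Definition monotone_flux g : Prop :=
  (forall b, {homo g^~ b : a a' / a <= a'}) /\
  (forall a, {homo g a : b b' / b <= b' >-> b' <= b}).

Definition lipschitz_flux g : Prop :=
  exists C : R, forall a1 b1 a2 b2,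
    `|g a1 b1 - g a2 b2| <= C * (`|a1 - a2| + `|b1 - b2|).

Definition entropy_flux g (a b c : R) : R :=
  g (Num.max a c) (Num.max b c) - g (Num.min a c) (Num.min b c).

(* The common left-hand side of the weak formulation and of the entropy
   inequality: eta is the conserved quantity, F the two-point flux. *)
Definition weak_form (T delta : R) w (u0 : R -> R) (eta : R -> R)
    (F : R -> R -> R) u phi : R :=
  (\int[leb]_(t in `]0, T[) \int[leb]_x (eta (u (x, t)) * dt phi (x, t)))
  + (\int[leb]_x (eta (u0 x) * phi (x, 0)))
  + (\int[leb]_(t in `]0, T[) \int[leb]_x \int[leb]_(h in `[0, delta])
       ((tau h phi (x, t) - phi (x, t)) / h
        * F (u (x, t)) (tau h u (x, t)) * w h)).

Definition weak_solution (T delta : R) w g (u0 : R -> R) u : Prop :=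
  Linfty_strip T u /\
  forall phi, test_function T phi ->
    weak_form T delta w u0 id g u phi = 0.

Definition entropy_solution (T delta : R) w g (u0 : R -> R) u : Prop :=
  Linfty_strip T u /\
  forall (c : R) phi, test_function T phi ->
    (forall x t : R, 0 <= t < T -> 0 <= phi (x, t)) ->
    0 <= weak_form T delta w u0 (fun a => `|a - c|)
           (fun a b => entropy_flux g a b c) u phi.

End Defs.

(* Main.v *)
Require Import Defs.
From HB Require Import structures.
From mathcomp Require Import all_boot all_order all_algebra.
From mathcomp Require Import all_classical all_reals all_analysis.
From mathcomp Require Import measurable_realfun ess_sup_inf.
From mathcomp Require Import ring lra.

Set Implicit Arguments.
Unset Strict Implicit.
Unset Printing Implicit Defensive.
Import Order.TTheory GRing.Theory Num.Theory.
Import numFieldNormedType.Exports.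

Local Open Scope classical_set_scope.
Local Open Scope ring_scope.

(** Since k(h) = w(h)/h is integrable, the nonlocal operator
    A(x,t) = int k(h) (g(u(x,t), u(x+h,t)) - g(u(x-h,t), u(x,t))) dh
    is a bounded function as soon as u is bounded: the equation is, for each
    fixed x, the ordinary differential equation du/dt = - A in the variable t,
    and no regularization in x is needed.

    Representation.  Fubini and the change of variables x -> x - h turn the weak
    form into an integral over x of one-dimensional weak forms in t
    ([weak_form_slices]).  With U(x,t) = u0(x) - int_0^t A(x,s) ds, the function
    U satisfies the same identity on every slice, so that u - U is orthogonal to
    the time derivatives of all test functions.  Every product of smooth bumps
    supported in the open strip is such a derivative on the strip, because a
    bump in time has an antiderivative vanishing near time T; hence u = U almost
    everywhere ([weak_solution_integrated]).

    Entropy inequality.  U(x,.) is Lipschitz, and by Lebesgue's differentiation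
    theorem its derivative is -A almost everywhere.  The chain rule for the
    nonsmooth entropy |. - c| is needed only as an inequality, which follows
    from convexity and difference quotients ([chain_inequality]); it produces
    sgn(U - c) A.  Pointwise, monotonicity of g gives
    q(a,b;c) - q(z,a;c) <= sgn(a - c) (g(a,b) - g(z,a))
    ([entropy_flux_difference_le]), and integrating this against k yields the
    entropy inequality ([bounded_weak_solution_entropy]).

    Uniqueness.  If |u - v| <= b e^(lambda t) almost everywhere, the Lipschitz
    bound on g and the representation give
    |u - v|(x,t) <= 4 C K b int_0^t e^(lambda s) ds with K the integral of k, so
    lambda >= 8 C K halves the constant b.  Iterating gives u = v
    ([bounded_weak_solution_unique]).

    All of this is done for functions that are measurable and bounded
    everywhere; a weak solution and its initial datum are first replaced by such
    representatives, which does not change the weak form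
    ([Linfty_strip_representative]). *)

(** * Integration and almost everywhere statements *)

Section RealIntegrals.
Context d (T : measurableType d) (R : realType) (m : {measure set T -> \bar R}).
Implicit Types f g : T -> R.

Lemma dominated_integrable f g : measurable_fun setT f ->
  (forall x, `|f x| <= g x) -> m.-integrable setT (EFin \o g) ->
  m.-integrable setT (EFin \o f).
Proof.
move=> mf fg; apply: le_integrable => //; first exact/measurable_EFinP.
by move=> x _ /=; rewrite lee_fin (le_trans (fg x))// ler_norm.
Qed.

Lemma ae_eq_Rintegral (D : set T) f g : measurable D ->
  measurable_fun D f -> measurable_fun D g ->
  {ae m, forall x, D x -> f x = g x} ->
  (\int[m]_(x in D) f x = \int[m]_(x in D) g x)%R.
Proof.
move=> mD mf mg fg; congr fine; apply: ae_eq_integral => //.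
- exact/measurable_EFinP.
- exact/measurable_EFinP.
- by apply: filterS fg => x fgx Dx; rewrite fgx.
Qed.

Lemma dominated_cvg_Rintegral (f_ : nat -> T -> R) f g :
  (forall n, measurable_fun setT (f_ n)) -> measurable_fun setT f ->
  m.-integrable setT (EFin \o g) ->
  (forall n x, `|f_ n x| <= g x) ->
  {ae m, forall x, f_ n x @[n --> \oo] --> f x} ->
  (\int[m]_x f_ n x)%R @[n --> \oo] --> (\int[m]_x f x)%R.
Proof.
move=> mf_ mf ig f_g f_f.
have [||||fi _ fc] := @dominated_convergence _ _ _ m setT measurableT
  (fun n => EFin \o f_ n) (EFin \o f) (EFin \o g) _ _ _ ig _.
- by move=> n; exact/measurable_EFinP.
- exact/measurable_EFinP.
- by apply: filterS f_f => x f_x _; apply: cvg_EFin => //; exact: nearW.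
- by apply: aeW => x n _; rewrite lee_fin f_g.
have -> : (\int[m]_x f x)%R = fine (\int[m]_x (EFin \o f) x) by [].
apply: fine_cvg; rewrite fineK //; exact: integrable_fin_num.
Qed.

(** Comparing f with max(f,g), which is above f everywhere and equal to g almost
    everywhere, reduces this to the pointwise comparison. *)
Lemma le_ae_Rintegral f g :
  m.-integrable setT (EFin \o f) -> m.-integrable setT (EFin \o g) ->
  {ae m, forall x, f x <= g x} ->
  (\int[m]_x f x <= \int[m]_x g x)%R.
Proof.
move=> fi gi fg.
have mf : measurable_fun setT f by apply/measurable_EFinP; exact: measurable_int fi.
have mg : measurable_fun setT g by apply/measurable_EFinP; exact: measurable_int gi.
rewrite (@ae_eq_Rintegral setT g (fun x => Num.max (f x) (g x)))//.
- apply: le_Rintegral => //.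
    apply: (@dominated_integrable _ (fun x => `|f x| + `|g x|)).
    + exact: measurable_maxr.
    + by move=> x; have [_|_] := leP (f x) (g x); rewrite ?lerDl ?lerDr.
    + exact: integrableD (integrable_norm fi) (integrable_norm gi).
  by move=> x _; rewrite le_max lexx.
- exact: measurable_maxr.
- by apply: filterS fg => x /max_idPr ->.
Qed.

End RealIntegrals.

Lemma le_ae_Rintegral_in d (X : measurableType d) (R : realType)
    (m : {measure set X -> \bar R}) (D : set X) (f g : X -> R) : measurable D ->
  m.-integrable D (EFin \o f) -> m.-integrable D (EFin \o g) ->
  {ae m, forall x, D x -> f x <= g x} ->
  (\int[m]_(x in D) f x <= \int[m]_(x in D) g x)%R.
Proof.
move=> mD fi gi fg; rewrite Rintegral_mkcond [leRHS]Rintegral_mkcond.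
apply: le_ae_Rintegral.
- by move: fi; rewrite integrable_mkcond// restrict_EFin.
- by move: gi; rewrite integrable_mkcond// restrict_EFin.
- apply: filterS fg => x fgx; rewrite !patchE; case: ifPn => [xD|//].
  by apply: fgx; exact: set_mem.
Qed.

Lemma integrable_mulr d (T : measurableType d) (R : realType)
    (m : {measure set T -> \bar R}) (D : set T) (f : T -> R) (c : R) :
  measurable D -> m.-integrable D (EFin \o f) ->
  m.-integrable D (EFin \o (fun x => f x * c)).
Proof. by move=> mD /(integrableZr mD c); apply: eq_integrable. Qed.

Lemma integrable_addr d (T : measurableType d) (R : realType)
    (m : {measure set T -> \bar R}) (D : set T) (f g : T -> R) :
  measurable D -> m.-integrable D (EFin \o f) -> m.-integrable D (EFin \o g) ->
  m.-integrable D (EFin \o (fun x => f x + g x)).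
Proof. by move=> mD fi gi; apply: eq_integrable (integrableD mD fi gi). Qed.

Lemma integrable_subr d (T : measurableType d) (R : realType)
    (m : {measure set T -> \bar R}) (D : set T) (f g : T -> R) :
  measurable D -> m.-integrable D (EFin \o f) -> m.-integrable D (EFin \o g) ->
  m.-integrable D (EFin \o (fun x => f x - g x)).
Proof. by move=> mD fi gi; apply: eq_integrable (integrableB mD fi gi). Qed.

Lemma measurable_patch d (T : measurableType d) (R : realType) (D : set T)
    (f : T -> R) : measurable D -> measurable_fun setT f ->
  measurable_fun setT (f \_ D).
Proof.
move=> mD mf; apply/(measurable_restrictT f mD); exact: measurable_funTS.
Qed.

Lemma ae_imply d (X : measurableType d) (R : realType)
    (m : {measure set X -> \bar R}) (P Q : set X) :
  (forall x, P x -> Q x) -> {ae m, forall x, P x} -> {ae m, forall x, Q x}.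
Proof.
by move=> PQ; apply: filterS => //; exact: (ae_filter_ringOfSetsType m).
Qed.

Lemma ae_imply2 d (X : measurableType d) (R : realType)
    (m : {measure set X -> \bar R}) (P P' Q : set X) :
  (forall x, P x -> P' x -> Q x) ->
  {ae m, forall x, P x} -> {ae m, forall x, P' x} -> {ae m, forall x, Q x}.
Proof.
by move=> PQ p p'; apply: filterS2 p p'.
Qed.

(** * Product measures *)

Section RealFubini.
Context d1 d2 (T1 : measurableType d1) (T2 : measurableType d2) (R : realType).
Context (m1 : {sigma_finite_measure set T1 -> \bar R}).
Context (m2 : {sigma_finite_measure set T2 -> \bar R}).
Implicit Types (f : T1 * T2 -> R) (a : T1 -> R) (b : T2 -> R).

Lemma measurable_Rintegral_snd f : measurable_fun setT f ->
  measurable_fun setT (fun x => \int[m2]_y f (x, y))%R.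
Proof.
move=> /measurable_EFinP mf.
apply: (@measurableT_comp _ _ _ _ _ _ fine) => //.
rewrite (_ : (fun x => _) = (fun x => \int[m2]_y ((EFin \o f)^\+ (x, y))) \-
   (fun x => \int[m2]_y ((EFin \o f)^\- (x, y))))%E.
  apply: emeasurable_funB.
    apply: (measurable_fun_fubini_tonelli_F (EFin \o f)^\+)%E => //.
    exact: measurable_funepos.
  apply: (measurable_fun_fubini_tonelli_F (EFin \o f)^\-)%E => //.
  exact: measurable_funeneg.
apply/funext => x /=; rewrite integralE.
by congr (_ - _)%E; apply: eq_integral => y _; rewrite ?funeposE ?funenegE.
Qed.

(** The separated functions a(x) b(y) serve as the dominating functions for every
    use of Fubini below: all integrands are bounded by such a product. *)
Lemma integrable_tensor a b :
  m1.-integrable setT (EFin \o a) -> m2.-integrable setT (EFin \o b) ->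
  (m1 \x m2)%E.-integrable setT (EFin \o (fun z => a z.1 * b z.2)).
Proof.
move=> ia ib.
have ma : measurable_fun setT a by apply/measurable_EFinP; exact: measurable_int ia.
have mb : measurable_fun setT b by apply/measurable_EFinP; exact: measurable_int ib.
apply/integrable12ltyP.
  apply/measurable_EFinP; apply: measurable_funM; exact: measurableT_comp.
under eq_integral => x _.
  under eq_integral do rewrite /= normrM EFinM.
  rewrite ge0_integralZl//; last by apply/measurable_EFinP; exact: measurableT_comp.
  over.
rewrite ge0_integralZr//.
- have /integrableP[_ ib'] := ib; have /integrableP[_ ia'] := ia.
  apply: lte_mul_pinfty => //; first exact: integral_ge0.
  by rewrite ge0_fin_numE//; exact: integral_ge0.
- by apply/measurable_EFinP; exact: measurableT_comp.
- exact: integral_ge0.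
Qed.

Section dominated.
Variables (f : T1 * T2 -> R) (a : T1 -> R) (b : T2 -> R).
Hypotheses (mf : measurable_fun setT f)
  (ia : m1.-integrable setT (EFin \o a)) (ib : m2.-integrable setT (EFin \o b))
  (fab : forall x y, `|f (x, y)| <= a x * b y).

Lemma tensor_dominated_integrable :
  (m1 \x m2)%E.-integrable setT (EFin \o f).
Proof.
apply: dominated_integrable (integrable_tensor ia ib) => // -[x y]; exact: fab.
Qed.

Lemma dominated_integrable_xsection x :
  m2.-integrable setT (EFin \o (fun y => f (x, y))).
Proof.
apply: (@dominated_integrable _ _ _ _ _ (fun y => a x * b y)).
- exact: measurableT_comp.
- by move=> y; exact: fab.
- rewrite (_ : _ \o _ = (fun y => (a x)%:E * (EFin \o b) y)%E)//.
  exact: integrableZl.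
Qed.

Lemma dominated_integrable_ysection y :
  m1.-integrable setT (EFin \o (fun x => f (x, y))).
Proof.
apply: (@dominated_integrable _ _ _ _ _ (fun x => a x * b y)).
- exact: measurableT_comp.
- by move=> x; exact: fab.
- rewrite (_ : _ \o _ = (fun x => (EFin \o a) x * (b y)%:E)%E)//.
  exact: integrableZr.
Qed.

Lemma integrable_Rintegral_snd :
  m1.-integrable setT (EFin \o (fun x => \int[m2]_y f (x, y))%R).
Proof.
apply: eq_integrable (integrable_fubini_F tensor_dominated_integrable) => //.
move=> x _; rewrite /fubini_F /= fineK//.
exact: integrable_fin_num (dominated_integrable_xsection x).
Qed.

Lemma Rintegral_prod_snd :
  (\int[m1]_x \int[m2]_y f (x, y) = \int[(m1 \x m2)%E]_z f z)%R.
Proof.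
congr fine; rewrite -(integral12_prod_meas1 tensor_dominated_integrable).
apply: eq_integral => x _; rewrite /= fineK//.
exact: integrable_fin_num (dominated_integrable_xsection x).
Qed.

Lemma Rintegral_prod_fst :
  (\int[m2]_y \int[m1]_x f (x, y) = \int[(m1 \x m2)%E]_z f z)%R.
Proof.
congr fine; rewrite -(integral21_prod_meas1 tensor_dominated_integrable).
apply: eq_integral => y _; rewrite /= fineK//.
exact: integrable_fin_num (dominated_integrable_ysection y).
Qed.

Lemma Rintegral_Fubini :
  (\int[m1]_x \int[m2]_y f (x, y) = \int[m2]_y \int[m1]_x f (x, y))%R.
Proof. by rewrite Rintegral_prod_snd Rintegral_prod_fst. Qed.

End dominated.

(** A null set of the product has null sections for almost every abscissa, since
    its measure is the integral of the measures of the sections. *)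
Lemma ae_prod_xsection (P : set (T1 * T2)) :
  {ae (m1 \x m2)%E, forall z, P z} -> {ae m1, forall x, {ae m2, forall y, P (x, y)}}.
Proof.
move=> [N [mN N0 PN]].
have : (\int[m1]_x `|(m2 \o xsection N) x|)%E = 0%E.
  rewrite -N0; apply: eq_integral => x _; rewrite gee0_abs//.
move/(ae_eq_integral_abs m1 measurableT (measurable_fun_xsection m2 mN)).1.
apply: filterS => x /(_ I) /= Nx0.
exists (xsection N x); split => //; first exact: measurable_xsection.
by move=> y /= nP; rewrite /xsection /= inE; exact: PN.
Qed.

Lemma ae_prod_ysection (P : set (T1 * T2)) :
  {ae (m1 \x m2)%E, forall z, P z} -> {ae m2, forall y, {ae m1, forall x, P (x, y)}}.
Proof.
move=> [N [mN N0 PN]].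
have N0' : (m1 \x^ m2)%E N = 0%E.
  rewrite -N0; apply/esym; apply: product_measure_unique => // A B mA mB.
  exact: product_measure2E.
have : (\int[m2]_y `|(m1 \o ysection N) y|)%E = 0%E.
  rewrite -N0'; apply: eq_integral => y _; rewrite gee0_abs//.
move/(ae_eq_integral_abs m2 measurableT (measurable_fun_ysection m1 mN)).1.
apply: filterS => y /(_ I) /= Ny0.
exists (ysection N y); split => //; first exact: measurable_ysection.
by move=> x /= nP; rewrite /ysection /= inE; exact: PN.
Qed.

Lemma ae_xsection_prod (P : set (T1 * T2)) : measurable P ->
  {ae m1, forall x, {ae m2, forall y, P (x, y)}} -> {ae (m1 \x m2)%E, forall z, P z}.
Proof.
move=> mP aeP; exists (~` P); split => //; first exact: measurableC.
have mCP : measurable (~` P) by exact: measurableC.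
transitivity (\int[m1]_x `|(m2 \o xsection (~` P)) x|)%E.
  by apply: eq_integral => x _; rewrite gee0_abs.
apply/(ae_eq_integral_abs m1 measurableT (measurable_fun_xsection m2 mCP)).2.
apply: filterS aeP => x [N [mN N0 NP]] _ /=.
apply: (subset_measure0 _ mN _ N0); first exact: measurable_xsection.
by move=> y; rewrite /xsection/= inE => nP; exact: NP.
Qed.

(** With [ae_prod_xsection] this exchanges the order of two almost everywhere
    quantifiers; the exchange is legitimate only for measurable predicates. *)
Lemma ae_ysection_prod (P : set (T1 * T2)) : measurable P ->
  {ae m2, forall y, {ae m1, forall x, P (x, y)}} -> {ae (m1 \x m2)%E, forall z, P z}.
Proof.
move=> mP aeP; exists (~` P); split => //; first exact: measurableC.
have mCP : measurable (~` P) by exact: measurableC.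
transitivity ((m1 \x^ m2)%E (~` P)).
  by apply: product_measure_unique => // A B mA mB; exact: product_measure2E.
transitivity (\int[m2]_y `|(m1 \o ysection (~` P)) y|)%E.
  by apply: eq_integral => x _; rewrite gee0_abs.
apply/(ae_eq_integral_abs m2 measurableT (measurable_fun_ysection m1 mCP)).2.
apply: filterS aeP => y [N [mN N0 NP]] _ /=.
apply: (subset_measure0 _ mN _ N0); first exact: measurable_ysection.
by move=> x; rewrite /ysection/= inE => nP; exact: NP.
Qed.

End RealFubini.

Lemma integrable_Rintegral_fst d1 d2 (T1 : measurableType d1)
    (T2 : measurableType d2) (R : realType)
    (m1 : {sigma_finite_measure set T1 -> \bar R})
    (m2 : {sigma_finite_measure set T2 -> \bar R})
    (f : T1 * T2 -> R) (a : T1 -> R) (b : T2 -> R) :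
  measurable_fun setT f ->
  m1.-integrable setT (EFin \o a) -> m2.-integrable setT (EFin \o b) ->
  (forall x y, `|f (x, y)| <= a x * b y) ->
  m2.-integrable setT (EFin \o (fun y => \int[m1]_x f (x, y))%R).
Proof.
move=> mf ia ib fab.
apply: (@integrable_Rintegral_snd _ _ _ _ _ m2 m1 (fun z => f (z.2, z.1)) b a) => //.
  apply: (measurableT_comp mf).
  exact: measurable_fun_pair measurable_snd measurable_fst.
by move=> y x; rewrite mulrC; exact: fab.
Qed.

(** * Translations and Borel measurability on the line and the plane *)

Section Lebesgue.
Context {R : realType}.
Local Notation mu := (@lebesgue_measure R).
Implicit Types (f : R -> R) (P : set R).

Lemma measurable_translation (h : R) :
  measurable_fun setT ((fun x => x + h) : R -> R).
Proof. exact: measurable_funD. Qed.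

Lemma lebesgue_measure_translation (h : R) (A : set R) : measurable A ->
  pushforward mu ((fun x => x + h) : R -> measurableTypeR R) A = mu A.
Proof.
move=> mA; apply/esym/lebesgue_measure_unique => //=.
  exact: measurable_translation.
move=> _ _ [[a b]] _ <-.
rewrite /pushforward.
have -> : (fun x => x + h) @^-1` `]a, b]%classic = `]a - h, b - h]%classic.
  by apply/seteqP; split => x /=; rewrite !in_itv/= ltrBlDr lerBrDr.
rewrite !lebesgue_measure_itv/= !lte_fin ltrD2r; case: ifP => // _.
by rewrite -!EFinB; congr EFin; ring.
Qed.

(** The image of Lebesgue measure under a translation is Lebesgue measure, both
    giving the same mass to half-open intervals. *)
Lemma Rintegral_translation f (h : R) : mu.-integrable setT (EFin \o f) ->
  (\int[mu]_x f (x + h) = \int[mu]_x f x)%R /\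
  mu.-integrable setT (EFin \o (fun x => f (x + h))).
Proof.
move=> /[dup] fi /integrableP[mf foo].
have mt : measurable_fun setT
    ((fun x => x + h) : measurableTypeR R -> measurableTypeR R).
  exact: measurable_translation.
have pE (g : R -> \bar R) : measurable_fun setT g -> (forall x, 0 <= g x)%E ->
    (\int[mu]_x g (x + h)%R = \int[mu]_x g x)%E.
  move=> mg g0; have := @ge0_integral_pushforward _ _ (measurableTypeR R)
    (measurableTypeR R) _ _ mt mu setT g measurableT mg.
  rewrite preimage_setT => <-//; apply: eq_measure_integral => A mA _.
  exact: lebesgue_measure_translation.
have fhi : mu.-integrable setT (EFin \o (fun x => f (x + h))).
  apply/integrableP; split; first exact: (measurableT_comp mf mt).
  by rewrite (pE (fun x => `|(f x)%:E|%E))//; exact: measurableT_comp.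
split => //; congr fine.
rewrite integralE [RHS]integralE; congr (_ - _)%E.
  rewrite -(pE ((fun x => (f x)%:E)^\+)%E)//; last exact: measurable_funepos.
  by apply: eq_integral => x _; rewrite !funeposE.
rewrite -(pE ((fun x => (f x)%:E)^\-)%E)//; last exact: measurable_funeneg.
by apply: eq_integral => x _; rewrite !funenegE.
Qed.

Lemma ae_translation P (h : R) : {ae mu, forall x, P x} ->
  {ae mu, forall x, P (x + h)}.
Proof.
move=> [N [mN N0 PN]]; have mt := measurable_translation h.
exists ((fun x => x + h) @^-1` N); split.
- by rewrite -[X in measurable X]setTI; exact: mt.
- by rewrite -N0 -(lebesgue_measure_translation h mN).
- by move=> x nP; apply: PN.
Qed.

Lemma ae_opp P : {ae mu, forall x, P x} -> {ae mu, forall x, P (- x)}.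
Proof.
move=> [N [mN N0 PN]].
exists (-%R @^-1` N); split.
- by rewrite -[X in measurable X]setTI; exact: oppr_measurable.
- by rewrite -N0 -(lebesgue_measureN mN).
- by move=> x nP; apply: PN.
Qed.

(** The sigma-algebra of the plane is the product one; the plane has a countable
    base of squares with rational centres, and squares are rectangles. *)
Lemma open2_measurable (U : set (R * R)) : open U -> measurable U.
Proof.
move=> oU.
(* Squares with rational centre and radius 1/(n+1). *)
pose B (p : rat * rat * nat) : set (R * R) :=
  (ball (ratr p.1.1 : R) (p.2.+1%:R^-1)) `*` (ball (ratr p.1.2 : R) (p.2.+1%:R^-1)).
rewrite (_ : U = \bigcup_(p in [set p | B p `<=` U]) B p); last first.
  apply/seteqP; split => [[x y] Uxy|[x y] [p pU]]; last exact: pU.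
  have /nbhs_ballP[e /= e0 eU] : nbhs (x, y) U by exact: open_nbhs_nbhs.
  have [n ne] : exists n : nat, n.+1%:R^-1 < e / 2.
    near \oo => n; exists n; near: n.
    by apply: near_infty_natSinv_lt (PosNum _); rewrite divr_gt0.
  have n0 : 0 < n.+1%:R^-1 :> R by rewrite invr_gt0.
  have rat_near (z r : R) : 0 < r -> exists q : rat, `|ratr q - z| < r.
    move=> r0; have [|q] := @rat_in_itvoo _ (z - r) (z + r); first by lra.
    by rewrite in_itv/= => qz; exists q; rewrite ltr_distl.
  have [q1 q1x] := rat_near x _ n0; have [q2 q2y] := rat_near y _ n0.
  have rne (a z q : R) : `|q - z| < n.+1%:R^-1 -> `|q - a| < n.+1%:R^-1 ->
      `|z - a| < e.
    move=> qz qa; rewrite (splitr e); apply: (le_lt_trans (ler_distD q _ _)).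
    by rewrite distrC; apply: ltrD; exact: lt_trans ne.
  exists (q1, q2, n); last by split.
  by move=> /= [a b] [/= Ba Bb]; apply: eU; split; [apply: rne q1x Ba|apply: rne q2y Bb].
rewrite bigcup_mkcond; apply: countable_bigcupT_measurable => // p.
by case: ifP => // _; apply: measurableX; exact: measurable_ball.
Unshelve. all: by end_near. Qed.

Lemma continuous2_measurable (f : R * R -> R) : continuous f ->
  measurable_fun setT f.
Proof.
move=> /continuousP cf.
apply: (measurability _ (RGenOpens.measurableE R)) => // _ [_ [a [b ->]] <-].
by rewrite setTI; apply: open2_measurable; apply: cf; exact: interval_open.
Qed.

End Lebesgue.

Lemma measurable_inv (R : realType) : measurable_fun setT (fun x : R => x^-1).
Proof.
rewrite -(setUv [set (0 : R)]); apply/measurable_funU => //; first exact: measurableC.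
split; first exact: measurable_fun_set1.
apply: open_continuous_measurable_fun; last first.
  by move=> x; rewrite inE /= => /eqP x0; exact: inv_continuous.
by rewrite openC; exact: closed_eq.
Qed.

Lemma measurable_strip (R : realType) (T : R) :
  measurable (strip T : set (measurableTypeR R * measurableTypeR R)).
Proof.
have -> : strip T = setT `*` `]0, T[%classic.
  by apply/seteqP; split => -[x t] /=; rewrite /strip/= in_itv//= => -[].
by apply: measurableX => //; exact: measurable_itv.
Qed.

(** * Calculus on the line *)

Section Calculus.
Context {R : realType}.
Local Notation mu := (@lebesgue_measure R).
Implicit Types (f F : R -> R) (D : set R).

Lemma integrable_scaled_indic (C a b : R) :
  mu.-integrable setT (EFin \o (fun t => C * \1_(`[a, b]) t)).
Proof.
rewrite (_ : _ \o _ = (fun t => C%:E * (EFin \o \1_(`[a, b])) t)%E)//.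
by apply: integrableZl => //; exact: integrable_indic_itv.
Qed.

Lemma bounded_support_integrable f (C a b : R) : measurable_fun setT f ->
  (forall t, `|f t| <= C) -> (forall t, ~~ (a <= t <= b) -> f t = 0) ->
  mu.-integrable setT (EFin \o f).
Proof.
move=> mf fC f0; apply: dominated_integrable (integrable_scaled_indic C a b) => //.
move=> t; rewrite indicE; case: (boolP (a <= t <= b)) => ht.
  by rewrite mem_set ?mulr1//= in_itv.
by rewrite f0 // normr0 memNset ?mulr0//= in_itv/=; exact/negP.
Qed.

Lemma bounded_itv_integrable f (C a b : R) : measurable_fun setT f ->
  (forall t, `|f t| <= C) -> mu.-integrable `]a, b[ (EFin \o f).
Proof.
move=> mf fC; rewrite integrable_mkcond //= (restrict_EFin f).
apply: (@bounded_support_integrable _ C a b).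
- by apply: measurable_patch.
- by move=> t; rewrite patchE; case: ifP => _ //; rewrite normr0 (le_trans _ (fC t)).
- move=> t ht; rewrite patchE memNset//= in_itv/= => /andP[h1 h2].
  by move: ht; rewrite !ltW.
Qed.

Lemma derivable_cvg_quotient f (x : R) (u : nat -> R) : derivable f x 1 ->
  (forall n, u n != 0) -> u n @[n --> \oo] --> 0 ->
  ((f (x + u n) - f x) / u n) @[n --> \oo] --> derive1 f x.
Proof.
move=> df u0 uc.
have dq : (f (x + h) - f x) / h @[h --> 0^'] --> derive1 f x.
  rewrite derive1E.
  have -> : (fun h => (f (x + h) - f x) / h) =
            (fun h : R => h^-1 *: (f (h *: 1 + x) - f x)).
    by apply/funext => h; rewrite /GRing.scale/= mulr1 mulrC (addrC h).
  exact: df.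
exact: (iffLR (cvgr_dnbhsP _ _ _) dq u (conj u0 uc)).
Qed.

Lemma bounded_derive_lipschitz f (C : R) : (forall x, derivable f x 1) ->
  (forall x, `|derive1 f x| <= C) -> forall a b, `|f a - f b| <= C * `|a - b|.
Proof.
move=> df fC a b; wlog ab : a b / b < a.
  move=> W; have [ab|ab|->] := ltgtP a b; last by rewrite !subrr normr0 mulr0.
    by rewrite distrC (distrC a); exact: W.
  exact: W.
have [||c _ ->] := @MVT _ f (derive1 f) b a ab.
- by move=> x _; rewrite derive1E; exact/derivableP.
- by apply: derivable_within_continuous => x _; exact: df.
- by rewrite normrM ler_wpM2r.
Qed.

(** The fundamental theorem of calculus, restated on an open interval because time
    integrals run over ]0, T[. *)
Lemma Rintegral_derive1 f (a b : R) : a < b -> (forall x, derivable f x 1) ->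
  continuous (derive1 f) -> (\int[mu]_(x in `]a, b[) derive1 f x = f b - f a)%R.
Proof.
move=> ab df cf'.
have cf : continuous f.
  by move=> x; apply/differentiable_continuous/derivable1_diffP; exact: df.
rewrite /Rintegral integral_itv_obnd_cbnd ?integral_itv_bndo_bndc; last 2 first.
- by apply/measurable_funTS/measurable_EFinP; exact: continuous_measurable_fun.
- by apply/measurable_funTS/measurable_EFinP; exact: continuous_measurable_fun.
have fab : derivable_oo_LRcontinuous f a b.
  split; first by move=> x _; exact: df.
    by apply: cvg_at_right_filter; exact: cf.
  by apply: cvg_at_left_filter; exact: cf.
by rewrite (continuous_FTC2 ab (continuous_subspaceT cf') fab (fun x _ => erefl)).
Qed.

Lemma lipschitz_continuous f (K : R) :
  (forall a b, `|f a - f b| <= K * `|a - b|) -> continuous f.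
Proof.
move=> fK x; apply/cvgrPdist_lt => e e0.
have K1 : 0 < `|K| + 1 by rewrite ltr_wpDl.
near=> y; apply: le_lt_trans (fK _ _) _.
apply: (@le_lt_trans _ _ ((`|K| + 1) * `|x - y|)).
  by rewrite ler_wpM2r// (le_trans (ler_norm _))// lerDl.
rewrite mulrC -ltr_pdivlMr//; near: y.
by apply: cvgr_dist_lt => //; rewrite divr_gt0.
Unshelve. all: by end_near. Qed.

End Calculus.

(** * Integrated rates and the chain inequality *)

Section IntegratedRate.
Context {R : realType}.
Local Notation mu := (@lebesgue_measure R).
Variables (T B U0 : R) (A : R -> R).
Hypotheses (mA : measurable_fun setT A)
  (AB : forall t, `|A t| <= B) (A0 : forall t, ~~ (0 < t < T) -> A t = 0).

(** The solution of U' = - A, U(0) = U0 when A vanishes for negative times.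
    Integrating from -oo makes U constant before time 0, so that the backward
    difference quotients of U make sense for all times. *)
Definition ode_solution (t : R) : R :=
  U0 - (\int[mu]_(s in `]-oo, t]) A s)%R.
Local Notation U := ode_solution.

Let AI : mu.-integrable setT (EFin \o A).
Proof.
apply: (@bounded_support_integrable _ _ B 0 T) => // t tT; apply: A0.
by apply: contra tT => /andP[t0 tT]; rewrite !ltW.
Qed.

Let AIS (D : set R) : measurable D -> mu.-integrable D (EFin \o A).
Proof. by move=> mD; apply: integrableS AI. Qed.

Lemma ode_solution_le0 (t : R) : t <= 0 -> U t = U0.
Proof.
move=> t0; rewrite /U (@eq_Rintegral _ _ _ _ _ (cst 0)) ?Rintegral_cst ?mul0r ?subr0//.
move=> s; rewrite inE/= in_itv/= => st; apply: A0; rewrite negb_and -leNgt.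
by rewrite (le_trans st).
Qed.

Lemma ode_solution_lipschitz (s t : R) : `|U t - U s| <= B * `|t - s|.
Proof.
wlog st : s t / s <= t.
  move=> W; have [/ltW ts|st] := ltP t s; last exact: W.
  by rewrite distrC (distrC t); exact: W.
have -> : U t - U s = - (\int[mu]_(r in `]s, t]) A r)%R.
  rewrite /U -(@Rintegral_itvB _ A -oo%O (BRight t) s)//; last exact: AIS.
  by ring.
rewrite normrN; apply: le_trans (le_normr_Rintegral _ _) _ => //; first exact: AIS.
apply: (@le_trans _ _ (\int[mu]_(r in `]s, t]) B)%R).
  apply: le_Rintegral => //.
  - exact: integrable_norm (AIS _).
  - by apply/integrableP; split; [exact: measurable_cst|
      rewrite integral_cst//= lebesgue_measure_itv/=; case: ifP => _;
      rewrite ?mule0 ?ltry// -EFinB -EFinM ltry].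
rewrite Rintegral_cst// [X in fine X]lebesgue_measure_itv/= lte_fin ger0_norm ?subr_ge0//.
by move: st; rewrite le_eqVlt => /predU1P[->|->//]; rewrite ltxx subrr.
Qed.

(** Lebesgue's differentiation theorem, A being merely integrable. *)
Lemma ode_solution_derivable : {ae mu, forall t, derivable U t 1 /\ derive1 U t = - A t}.
Proof.
have : locally_integrable [set: R] A by apply: open_integrable_locally => //; exact: openT.
move/(FTC1Ny (fun y => AIS (measurable_itv _))).
apply: filterS; first exact: (ae_filter_ringOfSetsType mu).
move=> t [dF F'].
have FA : is_derive t (1 : R) (fun x => \int[mu]_(s in `]-oo, x]) A s)%R (A t).
  by rewrite -F' derive1E; exact/derivableP.
have UA : is_derive t (1 : R) U (0 - A t) by exact: is_deriveB.
by split; [exact: ex_derive|rewrite derive1E derive_val sub0r].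
Qed.

End IntegratedRate.

Section ChainInequality.
Context {R : realType}.
Local Notation mu := (@lebesgue_measure R).
Variables (T B C L : R) (A U psi eta sigma : R -> R).
Hypotheses (T_gt0 : 0 < T) (mA : measurable_fun setT A)
  (AB : forall t, `|A t| <= B) (U_le0 : forall t, t <= 0 -> U t = U 0)
  (UB : forall s t, `|U t - U s| <= B * `|t - s|)
  (UA : {ae mu, forall t, derivable U t 1 /\ derive1 U t = - A t}).
Hypotheses (dpsi : forall t, derivable psi t 1) (cpsi' : continuous (derive1 psi))
  (psi'C : forall t, `|derive1 psi t| <= C) (psiC : forall t, `|psi t| <= C)
  (psiT : forall t, T <= t -> psi t = 0)
  (psi'T : forall t, T <= t -> derive1 psi t = 0)
  (etaL : forall a b, `|eta a - eta b| <= L * `|a - b|)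
  (msigma : measurable_fun setT sigma) (sigma1 : forall t, `|sigma t| <= 1)
  (subgradient : forall s t, 0 < t < T -> s < t ->
    psi t * (eta (U t) - eta (U s)) <= psi t * (sigma t * (U t - U s))).

Let W (t : R) := eta (U t) - eta (U 0).
Let e (n : nat) : R := n.+1%:R^-1.

Let e_gt0 n : 0 < e n. Proof. by rewrite invr_gt0. Qed.
Let B_ge0 : 0 <= B. Proof. by have := le_trans (normr_ge0 _) (UB 0 1); rewrite subr0 normr1 mulr1. Qed.
Let C_ge0 : 0 <= C. Proof. exact: le_trans (psiC 0). Qed.
Let L_ge0 : 0 <= L.
Proof. by have := le_trans (normr_ge0 _) (etaL 1 0); rewrite subr0 normr1 mulr1. Qed.

Let mpsi : measurable_fun setT psi.
Proof.
apply: continuous_measurable_fun => t.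
by apply/differentiable_continuous/derivable1_diffP.
Qed.

Let mpsi' : measurable_fun setT (derive1 psi).
Proof. exact: continuous_measurable_fun. Qed.

Let mU : measurable_fun setT U.
Proof.
apply: continuous_measurable_fun; apply: (@lipschitz_continuous _ _ B) => s t.
exact: UB.
Qed.

Let mW : measurable_fun setT W.
Proof.
apply: continuous_measurable_fun; apply: (@lipschitz_continuous _ _ (L * B)) => s t.
rewrite /W -mulrA opprB addrA subrK; apply: le_trans (etaL _ _) _.
by rewrite ler_wpM2l// UB.
Qed.

Let W_le0 t : t <= 0 -> W t = 0.
Proof. by move=> t0; rewrite /W U_le0// subrr. Qed.

Let W_bound t : 0 <= t <= T -> `|W t| <= L * (B * T).
Proof.
move=> /andP[t0 tT]; apply: le_trans (etaL _ _) _; rewrite ler_wpM2l//.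
apply: le_trans (UB _ _) _.
by rewrite subr0 ger0_norm// ler_wpM2l.
Qed.

Let psiW_integrable (f : R -> R) : measurable_fun setT f ->
  (forall t, `|f t| <= C) -> (forall t, T <= t -> f t = 0) ->
  mu.-integrable setT (EFin \o (fun t => f t * W t)).
Proof.
move=> mf fC fT.
apply: dominated_integrable (integrable_scaled_indic (C * (L * (B * T))) 0 T).
  exact: measurable_funM.
move=> t; rewrite indicE; case: (boolP (0 <= t <= T)) => tT.
  by rewrite mem_set ?mulr1//= ?in_itv// normrM ler_pM// W_bound.
rewrite memNset /= ?mulr0; last by rewrite in_itv/=; exact/negP.
move: tT; rewrite negb_and -!ltNge => /orP[/ltW/W_le0 ->|/ltW/fT ->].
  by rewrite mulr0 normr0.
by rewrite mul0r normr0.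
Qed.

Let mquotient (f : R -> R) (h c : R) : measurable_fun setT f ->
  measurable_fun setT (fun t => (f t - f (t + h)) / c).
Proof.
move=> mf; apply: measurable_funM; last exact: measurable_cst.
exact: measurable_funB mf (measurableT_comp mf (measurable_translation h)).
Qed.

(** Discrete integration by parts: translating one of the two terms moves the
    difference quotient from psi to W.  The backward quotient of W then appears
    multiplied by psi(t), and the subgradient inequality applies at time t,
    where sigma is evaluated. *)
Let quotient_le n :
  (\int[mu]_t ((psi t - psi (t + e n)) / e n * W t) <=
   \int[mu]_t ((fun t => psi t * sigma t * ((U t - U (t - e n)) / e n))
                 \_ `]0, T[) t)%R.
Proof.
pose f1 t := psi t * W t; pose f2 t := psi (t + e n) * W t.
have i1 : mu.-integrable setT (EFin \o f1) by exact: psiW_integrable.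
have i2 : mu.-integrable setT (EFin \o f2).
  apply: psiW_integrable => //.
    by apply: (measurableT_comp mpsi); exact: measurable_translation.
  by move=> t tT; apply: psiT; rewrite (le_trans tT)// lerDl ltW.
have [i2' i2e] := Rintegral_translation (- e n) i2.
have -> : (\int[mu]_t ((psi t - psi (t + e n)) / e n * W t) =
    \int[mu]_t ((f1 t - f2 (t - e n)) / e n))%R.
  transitivity (\int[mu]_t ((f1 t - f2 t) / e n))%R.
    by apply: eq_Rintegral => t _; rewrite /f1 /f2; ring.
  have i12 : mu.-integrable setT (EFin \o (fun t => f1 t - f2 t)).
    exact: integrableB i1 i2.
  have i12e : mu.-integrable setT (EFin \o (fun t => f1 t - f2 (t - e n))).
    exact: integrableB i1 i2e.
  rewrite (RintegralZr _ measurableT i12) (RintegralZr _ measurableT i12e).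
  by rewrite (RintegralB measurableT i1 i2) (RintegralB measurableT i1 i2e) i2'.
have if12 : mu.-integrable setT (EFin \o (fun t => (f1 t - f2 (t - e n)) / e n)).
  by apply: integrable_mulr => //; exact: integrableB i1 i2e.
apply: le_Rintegral => [//|//||].
  apply: (@bounded_support_integrable _ _ (C * B) 0 T).
  - apply: measurable_patch; first exact: measurable_itv.
    exact: measurable_funM (measurable_funM mpsi msigma) (mquotient _ _ mU).
  - move=> t; rewrite patchE; case: ifP => _; last by rewrite normr0 mulr_ge0.
    rewrite !normrM ler_pM//.
      by rewrite -[leRHS]mulr1 ler_pM.
    rewrite normfV (gtr0_norm (e_gt0 n)) ler_pdivrMr//.
    apply: le_trans (UB _ _) _.
    by rewrite subKr gtr0_norm.
  - move=> t tT; rewrite patchE memNset//= in_itv/= => /andP[t0 t1].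
    by move: tT; rewrite !ltW.
move=> t _; rewrite patchE /f1 /f2 subrK; case: ifPn => [|/negP tT].
  rewrite inE/= in_itv/= => tT.
  rewrite [leRHS](_ : _ = psi t * (sigma t * (U t - U (t - e n))) / e n); last by ring.
  rewrite ler_pM2r ?invr_gt0// -mulrBr /W opprB addrA subrK.
  by apply: subgradient => //; rewrite ltrBlDr ltrDl.
have : ~~ (0 < t < T) by apply/negP => t0T; apply: tT; rewrite inE/= in_itv.
rewrite -[leRHS]/(0 : R) negb_and -!leNgt => /orP[t0|Tt].
  rewrite (W_le0 t0) W_le0 ?mulr0 ?subrr ?mul0r// lerBlDr (le_trans t0)// add0r.
  exact: ltW.
by rewrite psiT// !mul0r subrr mul0r.
Qed.

(** The weak form of psi (eta o U)' <= psi sigma U' = - psi sigma A.  No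
    differentiability of eta o U is used: the discrete inequality [quotient_le]
    passes to the limit by dominated convergence, the quotients of psi converging
    everywhere because psi is differentiable, those of U almost everywhere.  The
    term eta(U(0)) psi(0) comes from subtracting the constant eta(U(0)) so that
    W vanishes for negative times. *)
Lemma chain_inequality :
  (\int[mu]_(t in `]0, T[) (psi t * sigma t * A t) <=
   \int[mu]_(t in `]0, T[) (eta (U t) * derive1 psi t) + eta (U 0) * psi 0)%R.
Proof.
have e0 : e n @[n --> \oo] --> 0 by exact: cvg_harmonic.
have cvgL : (\int[mu]_t ((psi t - psi (t + e n)) / e n * W t))%R @[n --> \oo]
    --> (\int[mu]_t (- derive1 psi t * W t))%R.
  apply: (@dominated_cvg_Rintegral _ _ _ mu
    (fun n t => (psi t - psi (t + e n)) / e n * W t) (fun t => - derive1 psi t * W t)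
    (fun t => C * (L * (B * T)) * \1_(`[0, T]) t)).
  - by move=> n; exact: measurable_funM (mquotient _ _ mpsi) mW.
  - exact: measurable_funM (measurable_funN mpsi') mW.
  - exact: integrable_scaled_indic.
  - move=> n t; have dC : `|(psi t - psi (t + e n)) / e n| <= C.
      rewrite normrM normfV (gtr0_norm (e_gt0 n)) ler_pdivrMr//.
      apply: le_trans (bounded_derive_lipschitz dpsi psi'C _ _) _.
      by rewrite opprD addrA subrr sub0r normrN gtr0_norm.
    rewrite indicE; case: (boolP (0 <= t <= T)) => tT.
      by rewrite mem_set ?mulr1//= ?in_itv// normrM ler_pM// W_bound.
    rewrite memNset /= ?mulr0; last by rewrite in_itv/=; exact/negP.
    move: tT; rewrite negb_and -!ltNge => /orP[/ltW/W_le0 ->|/ltW tT].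
      by rewrite mulr0 normr0.
    by rewrite !psiT ?subrr ?mul0r ?normr0// (le_trans tT)// lerDl ltW.
  - apply: aeW => t; apply: cvgM; last exact: cvg_cst.
    rewrite (_ : (fun n => _) = (fun n => - ((psi (t + e n) - psi t) / e n))).
      apply: cvgN; apply: derivable_cvg_quotient => //.
      by move=> n; rewrite gt_eqF.
    by apply/funext => n; rewrite -mulNr opprB.
have cvgR : (\int[mu]_t ((fun t => psi t * sigma t * ((U t - U (t - e n)) / e n))
                 \_ `]0, T[) t)%R @[n --> \oo]
    --> (\int[mu]_t ((fun t => psi t * sigma t * - A t) \_ `]0, T[) t)%R.
  apply: (@dominated_cvg_Rintegral _ _ _ mu
    (fun n => (fun t => psi t * sigma t * ((U t - U (t - e n)) / e n)) \_ `]0, T[)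
    ((fun t => psi t * sigma t * - A t) \_ `]0, T[) (fun t => C * B * \1_(`[0, T]) t)).
  - move=> n; apply: measurable_patch; first exact: measurable_itv.
    exact: measurable_funM (measurable_funM mpsi msigma) (mquotient _ _ mU).
  - apply: measurable_patch; first exact: measurable_itv.
    exact: measurable_funM (measurable_funM mpsi msigma) (measurable_funN mA).
  - exact: integrable_scaled_indic.
  - move=> n t; rewrite patchE; case: ifPn => [|_]; last first.
      by rewrite normr0 mulr_ge0// mulr_ge0.
    rewrite inE/= in_itv/= => /andP[t0 tT].
    have -> : \1_(`[0, T]) t = 1 :> R by rewrite indicE mem_set//= in_itv/= !ltW.
    rewrite mulr1 !normrM ler_pM//.
      by rewrite -[leRHS]mulr1 ler_pM.
    rewrite normfV (gtr0_norm (e_gt0 n)) ler_pdivrMr//.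
    apply: le_trans (UB _ _) _.
    by rewrite subKr gtr0_norm.
  - apply: filterS UA; first exact: (ae_filter_ringOfSetsType mu).
    move=> t [dU U']; have [tD|tD] := boolP (t \in (`]0, T[%classic : set R)).
      rewrite [X in _ --> X]patchE tD -U'.
      rewrite (_ : (fun n => _) =
          (fun n => psi t * sigma t * ((U (t + - e n) - U t) / - e n))); last first.
        by apply/funext => n; rewrite patchE tD invrN mulrN -mulNr opprB.
      apply: cvgM; first exact: cvg_cst.
      apply: derivable_cvg_quotient => //.
        by move=> n; rewrite oppr_eq0 gt_eqF.
      by rewrite -oppr0; exact: cvgN.
    rewrite patchE (negbTE tD) (_ : (fun n => _) = (fun=> point)).
      exact: cvg_cst.
    by apply/funext => n; rewrite patchE (negbTE tD).
have psi'W : mu.-integrable setT (EFin \o (fun t => derive1 psi t * W t)).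
  exact: psiW_integrable.
have mD : measurable (`]0, T[%classic : set (measurableTypeR R)) by exact: measurable_itv.
have psi'WD : mu.-integrable `]0, T[ (EFin \o (fun t => derive1 psi t * W t)).
  by apply: integrableS psi'W.
have : (\int[mu]_t (- derive1 psi t * W t) <=
    \int[mu]_t ((fun t => psi t * sigma t * - A t) \_ `]0, T[) t)%R.
  by apply: (ler_cvg_to cvgL cvgR); exact: nearW quotient_le.
rewrite -Rintegral_mkcond.
have -> : (\int[mu]_t (- derive1 psi t * W t) =
    - \int[mu]_(t in `]0, T[) (derive1 psi t * W t))%R.
  rewrite -mulN1r -(RintegralZl _ mD psi'WD).
  rewrite [RHS]Rintegral_mkcond; apply: eq_Rintegral => t _.
  rewrite patchE; case: ifPn => [_|/negP tT]; first by rewrite mulN1r mulNr.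
  have : ~~ (0 < t < T) by apply/negP => t0T; apply: tT; rewrite inE/= in_itv.
  rewrite -[RHS]/(0 : R) negb_and -!leNgt => /orP[t0|Tt].
    by rewrite W_le0// mulr0.
  by rewrite psi'T// oppr0 mul0r.
have iA : mu.-integrable `]0, T[ (EFin \o (fun t => psi t * sigma t * A t)).
  apply: (@bounded_itv_integrable _ _ (C * B)).
    exact: measurable_funM (measurable_funM mpsi msigma) mA.
  by move=> t; rewrite !normrM ler_pM// -[leRHS]mulr1 ler_pM.
have ipsi' : mu.-integrable `]0, T[ (EFin \o derive1 psi).
  exact: (@bounded_itv_integrable _ _ C).
have psi'etaU : mu.-integrable `]0, T[ (EFin \o (fun t => eta (U t) * derive1 psi t)).
  have -> : (fun t => eta (U t) * derive1 psi t) =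
      (fun t => derive1 psi t * W t + derive1 psi t * eta (U 0)).
    by apply/funext => t; rewrite /W; ring.
  by apply: integrable_addr => //; exact: integrable_mulr.
have -> : (\int[mu]_(t in `]0, T[) (psi t * sigma t * - A t) =
    - \int[mu]_(t in `]0, T[) (psi t * sigma t * A t))%R.
  rewrite -mulN1r -(RintegralZl _ mD iA).
  by apply: eq_Rintegral => t _; rewrite mulN1r mulrN.
rewrite lerN2 => /le_trans; apply.
have -> : (\int[mu]_(t in `]0, T[) (derive1 psi t * W t) =
    \int[mu]_(t in `]0, T[) (eta (U t) * derive1 psi t) -
    \int[mu]_(t in `]0, T[) (derive1 psi t * eta (U 0)))%R.
  rewrite -(RintegralB mD psi'etaU (integrable_mulr (eta (U 0)) mD ipsi')).
  by apply: eq_Rintegral => t _; rewrite /W; ring.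
rewrite (RintegralZr _ mD ipsi') Rintegral_derive1// psiT// sub0r.
by rewrite mulNr opprK mulrC.
Qed.

End ChainInequality.

(** * Smooth bumps and product test functions *)

Section SmoothFunctions.
Context {R : realType}.
Implicit Types f g : R -> R.

(** [derive1] is total, so a statement about iterated derivatives has to carry the
    existence of each of them. *)
Fixpoint n_derivable (n : nat) f : Prop :=
  if n is n'.+1 then (forall x, derivable f x 1) /\ n_derivable n' (derive1 f)
  else True.

Definition smooth1 f : Prop := forall n, n_derivable n f.

Lemma n_derivable_is_derive n f f' : (forall x : R, is_derive x 1 f (f' x)) ->
  n_derivable n f' -> n_derivable n.+1 f.
Proof.
move=> ff' nf'; split; first by move=> x; exact: ex_derive.
suff -> : derive1 f = f' by [].
by apply/funext => x; rewrite derive1E; exact: derive_val.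
Qed.

Lemma derivable_is_derive1 f : (forall x, derivable f x 1) ->
  forall x : R, is_derive x (1 : R) f (derive1 f x).
Proof. by move=> df x; rewrite derive1E; exact/derivableP. Qed.

Lemma n_derivableW n f : n_derivable n.+1 f -> n_derivable n f.
Proof. by elim: n f => [|n IH] f //= [df nf]; split => //; exact: IH. Qed.

Lemma n_derivable_add n f g : n_derivable n f -> n_derivable n g ->
  n_derivable n (fun x => f x + g x).
Proof.
elim: n f g => // n IH f g [df nf] [dg ng].
apply: (@n_derivable_is_derive _ _ (fun x => derive1 f x + derive1 g x)); last exact: IH.
by move=> x; apply: is_deriveD; exact: derivable_is_derive1.
Qed.

Lemma n_derivable_scale n c f : n_derivable n f -> n_derivable n (fun x => c * f x).
Proof.
elim: n f => // n IH f [df nf].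
apply: (@n_derivable_is_derive _ _ (fun x => c * derive1 f x)); last exact: IH.
by move=> x; apply: is_deriveZ; exact: derivable_is_derive1.
Qed.

Lemma n_derivable_mul n f g : n_derivable n f -> n_derivable n g ->
  n_derivable n (fun x => f x * g x).
Proof.
elim: n f g => // n IH f g /[dup] nf' [df nf] /[dup] ng' [dg ng].
apply: (@n_derivable_is_derive _ _ (fun x => f x * derive1 g x + g x * derive1 f x)).
  by move=> x; apply: is_deriveM; exact: derivable_is_derive1.
by apply: n_derivable_add; apply: IH => //; exact: n_derivableW.
Qed.

Lemma n_derivable_affine n f (a b : R) : n_derivable n f ->
  n_derivable n (fun x => f (a * x + b)).
Proof.
elim: n f => // n IH f [df nf].
apply: (@n_derivable_is_derive _ _ (fun x => a * derive1 f (a * x + b))).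
  move=> x; rewrite mulrC; apply: (@is_derive1_comp _ f (fun x => a * x + b)).
    exact: derivable_is_derive1.
  rewrite -[a in is_derive _ _ _ a]addr0; apply: is_deriveD.
  rewrite -[a in is_derive _ _ _ a]mulr1.
  by apply: (@is_deriveZ _ _ _ id).
by apply: n_derivable_scale; exact: IH.
Qed.

(** x^-m e^(-1/x), extended by 0.  The powers x^-m make the family stable, up to
    linear combinations, under differentiation; [flat_exp 0] is the usual smooth
    flat function. *)
Definition flat_exp (m : nat) (x : R) : R :=
  if 0 < x then x^-1 ^+ m * expR (- x^-1) else 0.

(** The term of order m+2 of the exponential series at 1/x bounds e^(1/x) from
    below.  Quadratic decay at 0 is what makes the derivative at 0 vanish. *)
Lemma flat_exp_bound m (x : R) : `|flat_exp m x| <= m.+2`!%:R * x ^+ 2.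
Proof.
rewrite /flat_exp; case: ifPn => [x0|_]; last by rewrite normr0 mulr_ge0// sqr_ge0.
have y0 : 0 <= x^-1 by rewrite invr_ge0 ltW.
rewrite ger0_norm ?mulr_ge0 ?exprn_ge0 ?expR_ge0// expRN ler_pdivrMr ?expR_gt0//.
have /(le_trans _) := expR_ge1Dxn m.+1 y0; move/(_ (x^-1 ^+ m.+2 / m.+2`!%:R)).
rewrite lerDr ler01 => /(_ isT); rewrite ler_pdivrMr ?ltr0n ?fact_gt0//.
rewrite -addn2 exprD exprVn (exprVn x 2) ler_pdivrMr ?exprn_gt0// => /le_trans; apply.
by rewrite -mulrA mulrC.
Qed.

Lemma is_derive_flat_exp m (x : R) :
  is_derive x (1 : R) (flat_exp m) (- m%:R * flat_exp m.+1 x + flat_exp m.+2 x).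
Proof.
have [x0|x0|->] := ltgtP x 0.
- rewrite {2 3}/flat_exp ltNge (ltW x0)/= mulr0 addr0.
  apply: (near_eq_is_derive _ (is_derive_cst (0 : R) x (1 : R))).
  near=> y; rewrite /flat_exp ltNge ifF//.
  by apply/negbTE; rewrite negbK ltW//; near: y; exact: lt_nbhsl.
- have near_x : \near x, x^-1 ^+ m * expR (- x^-1) = flat_exp m x.
    by near=> y; rewrite /flat_exp ifT//; near: y; exact: lt_nbhsr.
  apply: (near_eq_is_derive near_x).
  have dV : is_derive x (1 : R) (fun y : R => y^-1) (- x ^- 2 *: 1).
    by apply: (@is_deriveV _ id); rewrite ?gt_eqF.
  have dX := @is_deriveX _ _ _ m _ _ _ dV.
  have dN : is_derive x (1 : R) (fun y : R => - y^-1) (- (- x ^- 2 *: 1)).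
    exact: is_deriveN.
  have dE := @is_derive1_comp _ expR _ _ _ _ (is_derive_expR _) dN.
  rewrite (_ : (fun y => _) =
    (fun y : R => y^-1) ^+ m * (expR \o (fun y : R => - y^-1))); last first.
    by apply/funext => y; rewrite fctE exprfctE.
  apply: is_derive_eq (is_deriveM dX dE) _.
  rewrite exprfctE /flat_exp x0 /GRing.scale /= !mulr1 -!exprVn.
  case: (m) => [|m'] /=; first by rewrite !mul0r mulr0; ring.
  by rewrite !exprS; ring.
- rewrite {2 3}/flat_exp ltxx mulr0 addr0.
  have q0 : h^-1 *: (flat_exp m (h *: (1 : R) + 0) - flat_exp m 0) @[h --> 0^'] --> (0 : R).
    apply/cvgrPdist_le => e e0; near=> h.
    rewrite sub0r normrN {2}/flat_exp ltxx subr0 addr0 /GRing.scale/= mulr1.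
    have h0 : h != 0 by near: h; exact: nbhs_dnbhs_neq.
    rewrite normrM normfV mulrC ler_pdivrMr ?normr_gt0//.
    apply: le_trans (flat_exp_bound _ _) _.
    rewrite -[h ^+ 2]ger0_norm ?sqr_ge0// normrX expr2 mulrA ler_wpM2r// mulrC -ler_pdivlMr ?ltr0n ?fact_gt0//.
    near: h; apply: dnbhs0_le; by rewrite divr_gt0 ?ltr0n ?fact_gt0.
  by split; [apply/cvg_ex; exists 0|exact: cvg_lim].
Unshelve. all: by end_near. Qed.

Lemma n_derivable_flat_exp n m : n_derivable n (flat_exp m).
Proof.
elim: n m => // n IH m; apply: (n_derivable_is_derive (is_derive_flat_exp m)).
by apply: n_derivable_add => //; apply: n_derivable_scale.
Qed.

End SmoothFunctions.

Section Bumps.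
Context {R : realType}.
Local Notation mu := (@lebesgue_measure R).
Implicit Types (f alpha beta : R -> R) (a b x : R).

Lemma smooth1_derivable f : smooth1 f -> forall x, derivable f x 1.
Proof. by move=> /(_ 1%N)[]. Qed.

Lemma smooth1_derive1 f : smooth1 f -> smooth1 (derive1 f).
Proof. by move=> sf n; have [] := sf n.+1. Qed.

Lemma smooth1_continuous f : smooth1 f -> continuous f.
Proof.
move=> sf x; apply/differentiable_continuous/derivable1_diffP.
exact: smooth1_derivable.
Qed.

(** As k grows the two factors tend to 1 inside ]a, b[ while the support stays
    fixed: these are smooth minorants converging to the indicator of ]a, b[. *)
Definition bump a b (k : nat) x : R :=
  flat_exp 0 (k.+1%:R * (x - a)) * flat_exp 0 (k.+1%:R * (b - x)).

Lemma smooth1_bump a b k : smooth1 (bump a b k).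
Proof.
move=> n; apply: n_derivable_mul.
  rewrite (_ : (fun x => _) = (fun x => flat_exp 0 (k.+1%:R * x + - k.+1%:R * a))).
    exact/n_derivable_affine/n_derivable_flat_exp.
  by apply/funext => x; congr flat_exp; ring.
rewrite (_ : (fun x => _) = (fun x => flat_exp 0 (- k.+1%:R * x + k.+1%:R * b))).
  exact/n_derivable_affine/n_derivable_flat_exp.
by apply/funext => x; congr flat_exp; ring.
Qed.

Lemma flat_exp0_ge0 x : 0 <= flat_exp 0 x.
Proof. by rewrite /flat_exp; case: ifP => // _; rewrite mul1r expR_ge0. Qed.

Lemma flat_exp0_le1 x : flat_exp 0 x <= 1.
Proof.
rewrite /flat_exp; case: ifP => // x0; rewrite mul1r -expR0 ler_expR oppr_le0.
by rewrite invr_ge0 ltW.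
Qed.

Lemma bump_ge0 a b k x : 0 <= bump a b k x.
Proof. by rewrite mulr_ge0// flat_exp0_ge0. Qed.

Lemma bump_norm_le1 a b k x : `|bump a b k x| <= 1.
Proof.
by rewrite ger0_norm ?bump_ge0// mulr_ile1 ?flat_exp0_ge0 ?flat_exp0_le1.
Qed.

Lemma bump_eq0 a b k x : ~~ (a < x < b) -> bump a b k x = 0.
Proof.
rewrite negb_and -!leNgt /bump /flat_exp !pmulr_rgt0 ?ltr0n// !subr_gt0.
by case/orP; rewrite leNgt => /negbTE ->; rewrite ?mul0r ?mulr0.
Qed.

Lemma flat_exp0_cvg1 x : 0 < x -> flat_exp 0 (k.+1%:R * x) @[k --> \oo] --> (1 : R).
Proof.
move=> x0.
rewrite (_ : (fun k => _) = (fun k : nat => expR (- (k.+1%:R^-1 * x^-1)))); last first.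
  by apply/funext => k; rewrite /flat_exp pmulr_rgt0 ?ltr0n// x0 mul1r invfM.
rewrite -[X in _ --> X]expR0; apply: continuous_cvg; first exact: continuous_expR.
rewrite -[X in _ --> X]oppr0; apply: cvgN; rewrite -[X in _ --> X](mul0r x^-1).
by apply: cvgM; [exact: cvg_harmonic|exact: cvg_cst].
Qed.

Lemma bump_cvg_indic a b x :
  bump a b k x @[k --> \oo] --> (\1_(`]a, b[) x : R).
Proof.
rewrite indicE; have [xab|xab] := boolP (a < x < b).
  rewrite mem_set/=; last by rewrite in_itv.
  move: xab => /andP[ax xb]; rewrite -[X in _ --> X]mulr1.
  by apply: cvgM; apply: flat_exp0_cvg1; rewrite subr_gt0.
rewrite memNset/=; last by rewrite in_itv/=; exact/negP.
rewrite (_ : (fun k => _) = (fun=> 0)); first exact: cvg_cst.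
by apply/funext => k; rewrite bump_eq0.
Qed.

Lemma measurable_bump a b k : measurable_fun setT (bump a b k).
Proof. apply: continuous_measurable_fun; exact/smooth1_continuous/smooth1_bump. Qed.

Lemma integrable_bump a b k : mu.-integrable setT (EFin \o bump a b k).
Proof.
apply: (@bounded_support_integrable _ _ 1 a b).
- exact: measurable_bump.
- exact: bump_norm_le1.
- move=> x xab; apply: bump_eq0; apply: contra xab => /andP[ax xb].
  by rewrite !ltW.
Qed.

(** A primitive of f alone is constant, but in general nonzero, after b.  To make
    it vanish there, f is corrected by minus its translate by T into negative
    times, where only the restriction to positive times matters. *)
Lemma supported_antiderivative (T a b : R) f : 0 < a -> a < b -> b < T ->
  smooth1 f -> (forall x, ~~ (a < x < b) -> f x = 0) ->
  mu.-integrable setT (EFin \o f) ->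
  exists beta, [/\ smooth1 beta, forall t, 0 < t -> derive1 beta t = f t
    & forall t, ~~ (- T <= t <= b) -> beta t = 0].
Proof.
move=> a0 ab bT sf f0 fi; pose g t := f t - f (t + T).
have [iT iTi] := Rintegral_translation T fi.
have ig : mu.-integrable setT (EFin \o g).
  by apply: integrable_subr => //; exact: fi.
have cg : smooth1 g.
  move=> n; apply: n_derivable_add; first exact: sf.
  rewrite (_ : (fun x => _) = (fun x => -1 * f (1 * x + T))).
    exact/n_derivable_scale/n_derivable_affine/sf.
  by apply/funext => x; rewrite mul1r mulN1r.
(* The integral of g over the line vanishes, so beta is 0 on both sides. *)
pose beta t := (\int[mu]_(s in `]-oo, t]) g s)%R.
have dbeta t : derivable beta t 1 /\ derive1 beta t = g t.
  apply: (@continuous_FTC1 _ g -oo%O t (t + 1)) => //.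
  - by rewrite ltrDl.
  - by apply: integrableS ig.
  - by rewrite ltNyr.
  - exact: smooth1_continuous.
exists beta; split.
- move=> [//|n]; split; first by move=> x; have [] := dbeta x.
  suff -> : derive1 beta = g by exact: cg.
  by apply/funext => x; have [] := dbeta x.
- move=> t t0; have [_ ->] := dbeta t; rewrite /g [X in _ - X]f0 ?subr0//.
  by rewrite negb_and -!leNgt; apply/orP; right; rewrite (ltW (lt_trans bT _))// ltrDr.
- move=> t; rewrite negb_and -!ltNge => /orP[tT|tb].
    rewrite /beta (@eq_Rintegral _ _ _ _ _ (cst 0)) ?Rintegral_cst ?mul0r//.
    move=> s; rewrite inE/= in_itv/= => st; rewrite /g !f0 ?subrr//.
      by rewrite negb_and -!leNgt; apply/orP; left; lra.
    by rewrite negb_and -!leNgt; apply/orP; left; lra.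
  transitivity (\int[mu]_s g s)%R.
    rewrite /beta Rintegral_mkcond; apply: eq_Rintegral => s _; rewrite patchE.
    case: ifPn => // /negP; rewrite inE/= in_itv/= => /negP; rewrite -ltNge => ts.
    rewrite /g !f0 ?subrr// negb_and -!leNgt; apply/orP; right; lra.
  rewrite (@RintegralB _ _ _ mu setT _ _ measurableT fi iTi).
  by rewrite iT subrr.
Qed.

End Bumps.

Section TensorTestFunctions.
Context {R : realType}.
Implicit Types alpha beta : R -> R.

(** Partial derivatives of a product alpha(x) beta(t) are again of this form, so
    smoothness of the factors gives existence and continuity of all of them. *)
Lemma partials_tensor alpha beta (s : seq bool) : smooth1 alpha -> smooth1 beta ->
  exists alpha' beta', [/\ smooth1 alpha', smooth1 beta' &
    partials s (fun z => alpha z.1 * beta z.2) = (fun z => alpha' z.1 * beta' z.2)].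
Proof.
move=> sa sb; elim: s => [|i s [a' [b' [sa' sb' E]]]]; first by exists alpha, beta.
rewrite /partials /= -/(partials s _) E.
case: i.
  exists a', (derive1 b'); split => //; first exact: smooth1_derive1.
  apply/funext => -[x t]; rewrite /dt /= !derive1E.
  have db' := is_deriveZ (a' x) (derivable_is_derive1 (smooth1_derivable sb') t).
  by rewrite (derive_val (is_derive := db')) derive1E.
exists (derive1 a'), b'; split => //; first exact: smooth1_derive1.
apply/funext => -[x t]; rewrite /dx /= !derive1E.
rewrite (_ : (fun y => _) = (fun y => b' t * a' y)); last first.
  by apply/funext => y; rewrite mulrC.
have da' := is_deriveZ (b' t) (derivable_is_derive1 (smooth1_derivable sa') x).
by rewrite (derive_val (is_derive := da')) mulrC derive1E.
Qed.

Lemma test_function_tensor (T a b c d : R) alpha beta : smooth1 alpha -> smooth1 beta ->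
  (forall x, ~~ (a <= x <= b) -> alpha x = 0) ->
  (forall t, ~~ (c <= t <= d) -> beta t = 0) -> d < T ->
  test_function T (fun z => alpha z.1 * beta z.2).
Proof.
move=> sa sb a0 b0 dT; set phi := fun z => _.
have cbox : compact (`[a, b] `*` `[c, d] : set (R * R)).
  by apply: compact_setX; exact: segment_compact.
have box_closed : closed (`[a, b] `*` `[c, d] : set (R * R)).
  by apply: closedI; apply: closed_comp; [move=> z _; exact: cvg_fst|
    exact: itv_closed|move=> z _; exact: cvg_snd|exact: itv_closed].
have supp : closed_support phi `<=` `[a, b] `*` `[c, d].
  rewrite [X in _ `<=` X](iffLR (closure_id _) box_closed); apply: closureS.
  move=> [x t] /=; rewrite /phi /= mulf_eq0 negb_or => /andP[ax bt].
  split; rewrite /= in_itv/=.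
    by apply: contraNT ax => /a0 ->.
  by apply: contraNT bt => /b0 ->.
split.
- move=> s; have [a' [b' [sa' sb' ->]]] := partials_tensor s sa sb; split.
  + move=> z; apply: cvgM.
      by apply: (continuous_comp (f := fst)); [exact: cvg_fst|exact: smooth1_continuous].
    by apply: (continuous_comp (f := snd)); [exact: cvg_snd|exact: smooth1_continuous].
  + by move=> x t /=; apply: derivableM => //; exact: smooth1_derivable.
  + by move=> x t /=; apply: derivableM => //; exact: smooth1_derivable.
- by apply: subclosed_compact supp => //; exact: closed_closure.
- move=> z /supp[_ /=]; rewrite in_itv/= => /andP[_ zd].
  exact: le_lt_trans zd dT.
Qed.

End TensorTestFunctions.

(** * Properties of test functions *)

Section TestFunctions.
Context {R : realType}.
Variables (T : R) (phi : R * R -> R).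
Hypothesis phiT : test_function T phi.

Lemma test_function_continuous : continuous phi.
Proof. by have [/(_ [::])[]] := phiT. Qed.

Lemma test_function_dt_continuous : continuous (dt phi).
Proof. by have [/(_ [:: true])[]] := phiT. Qed.

Lemma test_function_derivable x t : derivable (fun s => phi (x, s)) t 1.
Proof. by have [/(_ [::])[_ _ d] _ _] := phiT; exact: d. Qed.

Lemma test_function_eq0 z : ~ closed_support phi z -> phi z = 0.
Proof.
move=> nz; apply/eqP; apply: contra_notT nz => phiz; exact: subset_closure.
Qed.

Lemma test_function_dt_eq0 z : ~ closed_support phi z -> dt phi z = 0.
Proof.
move=> nz; rewrite /dt derive1E.
have zK : nbhs z (~` closed_support phi).
  by apply: open_nbhs_nbhs; split => //; apply: closed_openC; exact: closed_closure.
have near_z : \forall s \near z.2, (0 : R) = phi (z.1, s).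
  move: zK; rewrite {1}(surjective_pairing z) => -[[P Q] /= [Pz1 Qz2] PQ].
  near=> s; apply/esym/test_function_eq0; apply: PQ; split => /=.
    exact: nbhs_singleton.
  by near: s.
have d0 := near_eq_is_derive near_z (is_derive_cst (0 : R) z.2 (1 : R)).
by rewrite (derive_val (is_derive := d0)).
Unshelve. all: by end_near. Qed.

Lemma test_function_ge z : T <= z.2 -> ~ closed_support phi z.
Proof.
by move=> Tz K; have [_ _ /(_ z K)] := phiT; rewrite /= ltNge Tz.
Qed.

Lemma supported_bounded (f : R * R -> R) : continuous f ->
  (forall z, ~ closed_support phi z -> f z = 0) ->
  exists C, forall z, `|f z| <= C.
Proof.
move=> cf f0; have [_ cK _] := phiT.
have : bounded_set (f @` closed_support phi).
  by apply: compact_bounded; apply: continuous_compact => //; exact: continuous_subspaceT.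
move=> [M [Mreal /(_ (`|M| + 1))]]; rewrite (le_lt_trans (ler_norm M)) ?ltrDl// => /(_ isT) fM.
exists (`|M| + 1) => z; have [Kz|/f0 ->] := pselect (closed_support phi z).
  by apply: fM; exists z.
by rewrite normr0 addr_ge0.
Qed.

(** The support being compact, phi and its time derivative are bounded and vanish
    outside a bounded range of x; only the bound on x is recorded, the time
    variable ranging over the bounded interval ]0, T[. *)
Lemma test_function_bounds : exists N C, [/\ 0 < N, forall z, `|phi z| <= C,
  forall z, `|dt phi z| <= C &
  forall z, N < `|z.1| -> phi z = 0 /\ dt phi z = 0].
Proof.
have [C1 hC1] := supported_bounded test_function_continuous test_function_eq0.
have [C2 hC2] := supported_bounded test_function_dt_continuous test_function_dt_eq0.
have [_ cK _] := phiT.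
have : bounded_set (fst @` closed_support phi).
  apply: compact_bounded; apply: continuous_compact => //.
  by apply: continuous_subspaceT => z; exact: cvg_fst.
move=> [M [Mreal /(_ (`|M| + 1))]]; rewrite (le_lt_trans (ler_norm M)) ?ltrDl// => /(_ isT) KM.
exists (`|M| + 1), (Num.max C1 C2); split.
- by rewrite ltr_wpDl.
- by move=> z; rewrite le_max hC1.
- by move=> z; rewrite le_max hC2 orbT.
- move=> z; rewrite ltNge => /negP zM.
  have nK : ~ closed_support phi z by move=> K; apply: zM; apply: KM; exists z.
  by split; [exact: test_function_eq0|exact: test_function_dt_eq0].
Qed.

End TestFunctions.

(** * The nonlocal operator and the weak form on slices *)

Section FubiniStrip.
Context {R : realType}.
Local Notation mu := (@lebesgue_measure R).

Section slab.
Variables (T : R) (f : R * R -> R) (a : R -> R).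
Hypotheses (mf : measurable_fun setT f) (ia : mu.-integrable setT (EFin \o a))
  (fa : forall x t, `|f (x, t)| <= a x).

Let g (z : R * R) : R := f z * \1_(`]0, T[) z.2.

Let mg : measurable_fun setT g.
Proof.
apply: measurable_funM => //.
apply: (measurableT_comp (f := \1_(`]0, T[) : R -> R)) => //.
Qed.

Let i1 : mu.-integrable setT (EFin \o \1_(`]0, T[)).
Proof. exact: integrable_indic_itv. Qed.

Let ga x t : `|g (x, t)| <= a x * \1_(`]0, T[) t.
Proof. by rewrite /g normrM (ger0_norm (_ : 0 <= \1_(`]0, T[) t))// ler_wpM2r. Qed.

Let restrict_snd x :
  (\int[mu]_(t in `]0, T[) f (x, t) = \int[mu]_t g (x, t))%R.
Proof.
rewrite Rintegral_mkcond; apply: eq_Rintegral => t _.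
by rewrite patchE /g /= indicE; case: ifP => _; rewrite ?mulr1 ?mulr0.
Qed.

Let restrict_fst :
  (\int[mu]_(t in `]0, T[) \int[mu]_x f (x, t) = \int[mu]_t \int[mu]_x g (x, t))%R.
Proof.
rewrite Rintegral_mkcond; apply: eq_Rintegral => t _.
rewrite patchE /g /= indicE; case: ifP => _.
  by apply: eq_Rintegral => x _; rewrite mulr1.
rewrite (@eq_Rintegral _ _ _ mu setT (cst 0)) ?Rintegral_cst ?mul0r//.
by move=> x _; rewrite mulr0.
Qed.

Lemma Fubini_slab :
  (\int[mu]_(t in `]0, T[) \int[mu]_x f (x, t) =
   \int[mu]_x \int[mu]_(t in `]0, T[) f (x, t))%R.
Proof.
rewrite restrict_fst -(@Rintegral_Fubini _ _ _ _ R mu mu g _ _ mg ia i1 ga).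
by apply: eq_Rintegral => x _; rewrite restrict_snd.
Qed.

Lemma integrable_slab :
  mu.-integrable setT (EFin \o (fun x => \int[mu]_(t in `]0, T[) f (x, t))%R).
Proof.
rewrite (_ : (fun x => _) = (fun x => \int[mu]_t g (x, t))%R); last first.
  by apply/funext => x; rewrite restrict_snd.
exact: (@integrable_Rintegral_snd _ _ _ _ R mu mu g _ _ mg ia i1 ga).
Qed.

Lemma Rintegral_slab_prod :
  (\int[mu]_x \int[mu]_(t in `]0, T[) f (x, t) =
   \int[(mu \x mu)%E]_z (f z * \1_(`]0, T[) z.2))%R.
Proof.
rewrite -(@Rintegral_prod_snd _ _ _ _ R mu mu g _ _ mg ia i1 ga).
by apply: eq_Rintegral => x _; rewrite restrict_snd.
Qed.

End slab.
End FubiniStrip.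

Lemma integrable_slab_fst (R : realType) (T : R) (f : R * R -> R) (a : R -> R) :
  measurable_fun setT f -> lebesgue_measure.-integrable setT (EFin \o a) ->
  (forall x t, `|f (x, t)| <= a x) ->
  lebesgue_measure.-integrable `]0, T[
    (EFin \o (fun t => \int[lebesgue_measure]_x f (x, t))%R).
Proof.
move=> mf ia fa; pose g (z : R * R) : R := f z * \1_(`]0, T[) z.2.
have mg : measurable_fun setT g.
  apply: measurable_funM => //.
  by apply: (measurableT_comp (f := \1_(`]0, T[) : R -> R)).
have i1 : lebesgue_measure.-integrable setT (EFin \o (\1_(`]0, T[) : R -> R)).
  exact: integrable_indic_itv.
have ga x t : `|g (x, t)| <= a x * \1_(`]0, T[) t.
  by rewrite /g normrM (ger0_norm (_ : 0 <= \1_(`]0, T[) t))// ler_wpM2r.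
rewrite integrable_mkcond//= restrict_EFin.
rewrite (_ : (_ \_ _) = (fun t => \int[lebesgue_measure]_x g (x, t))%R).
  exact: (@integrable_Rintegral_fst _ _ _ _ R lebesgue_measure lebesgue_measure
    g _ _ mg ia i1 ga).
apply/funext => t; rewrite patchE /g /= indicE; case: ifP => _.
  by apply: eq_Rintegral => x _; rewrite mulr1.
rewrite (@eq_Rintegral _ _ _ _ setT (cst 0)) ?Rintegral_cst ?mul0r//.
by move=> x _; rewrite mulr0.
Qed.

Section NonlocalFlux.
Context {R : realType}.
Local Notation mu := (@lebesgue_measure R).
Variables (delta BF : R) (k : R -> R) (F : R -> R -> R) (u : R * R -> R).
Hypotheses (ik : mu.-integrable setT (EFin \o k)) (k_ge0 : forall h, 0 <= k h)
  (k_supp : forall h, ~~ (0 <= h <= delta) -> k h = 0)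
  (mF : measurable_fun setT (fun z : R * R => F z.1 z.2))
  (mu_ : measurable_fun setT u) (FB : forall z z', `|F (u z) (u z')| <= BF).

(** The nonlocal operator at z = (x, t), with k(h) for w(h)/h. *)
Definition nonlocal_flux (z : R * R) : R :=
  (\int[mu]_h (k h * (F (u z) (u (z.1 + h, z.2)) - F (u (z.1 - h, z.2)) (u z))))%R.

Let mk : measurable_fun setT k.
Proof. by apply/measurable_EFinP; exact: measurable_int ik. Qed.

Let mflux d (X : measurableType d) (p q : X -> R * R) : measurable_fun setT p ->
  measurable_fun setT q -> measurable_fun setT (fun y => F (u (p y)) (u (q y))).
Proof.
move=> mp mq; have := measurableT_comp mF
  (measurable_fun_pair (measurableT_comp mu_ mp) (measurableT_comp mu_ mq)).
exact.
Qed.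

Lemma measurable_nonlocal_integrand : measurable_fun setT
  (fun y : (R * R) * R => k y.2 * (F (u y.1) (u (y.1.1 + y.2, y.1.2)) -
                                   F (u (y.1.1 - y.2, y.1.2)) (u y.1))).
Proof.
have m11 : measurable_fun setT (fun y : (R * R) * R => y.1.1).
  exact: measurableT_comp measurable_fst measurable_fst.
have m12 : measurable_fun setT (fun y : (R * R) * R => y.1.2).
  exact: measurableT_comp measurable_snd measurable_fst.
have m2 : measurable_fun setT (fun y : (R * R) * R => y.2) by exact: measurable_snd.
apply: measurable_funM; first exact: measurableT_comp mk m2.
apply: measurable_funB; apply: mflux.
- exact: measurable_fst.
- by apply: measurable_fun_pair m12; exact: measurable_funD.
- by apply: measurable_fun_pair m12; exact: measurable_funB.
- exact: measurable_fst.
Qed.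

Lemma measurable_nonlocal_flux : measurable_fun setT nonlocal_flux.
Proof. exact: (measurable_Rintegral_snd mu measurable_nonlocal_integrand). Qed.

Let integrand_bound z h :
  `|k h * (F (u z) (u (z.1 + h, z.2)) - F (u (z.1 - h, z.2)) (u z))| <= k h * (BF *+ 2).
Proof.
rewrite normrM ger0_norm// ler_wpM2l//; apply: le_trans (ler_normB _ _) _.
by rewrite mulr2n lerD.
Qed.

Lemma integrable_nonlocal_integrand z : mu.-integrable setT
  (EFin \o (fun h => k h * (F (u z) (u (z.1 + h, z.2)) - F (u (z.1 - h, z.2)) (u z)))).
Proof.
apply: dominated_integrable (integrable_mulr (BF *+ 2) measurableT ik).
  exact: measurableT_comp measurable_nonlocal_integrand (measurable_pair1 z).
exact: integrand_bound.
Qed.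

Lemma nonlocal_flux_bound z : `|nonlocal_flux z| <= (\int[mu]_h k h)%R * (BF *+ 2).
Proof.
apply: le_trans (le_normr_Rintegral _ (integrable_nonlocal_integrand z)) _ => //.
rewrite -(RintegralZr _ measurableT ik); apply: le_Rintegral => //.
- exact: integrable_norm (integrable_nonlocal_integrand z).
- exact: integrable_mulr.
Qed.

(** Summation by parts: for fixed h, translating x by h in the term
    p(x+h) F(u(x), u(x+h)) turns it into p(x) F(u(x-h), u(x)).  Fubini is needed
    to fix h first, and is justified because p has bounded support, F is bounded
    and k is integrable and supported in [0, delta]. *)
Lemma Rintegral_by_parts_nonlocal (t N C : R) (p : R -> R) :
  measurable_fun setT p -> (forall x, `|p x| <= C) ->
  (forall x, N < `|x| -> p x = 0) -> 0 <= delta ->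
  (\int[mu]_x \int[mu]_h ((p (x + h) - p x) * F (u (x, t)) (u (x + h, t)) * k h) =
   - \int[mu]_x (p x * nonlocal_flux (x, t)))%R.
Proof.
move=> mp pC pN d0.
(* A nonzero p(x) or p(x + h) with 0 <= h <= delta forces |x| <= N + delta. *)
pose a x : R := (C *+ 2 * BF) * \1_(`[- (N + delta), N + delta]) x.
have C0 : 0 <= C by exact: le_trans (pC 0).
have BF0 : 0 <= BF by exact: le_trans (FB (0, 0) (0, 0)).
have ia : mu.-integrable setT (EFin \o a) by exact: integrable_scaled_indic.
have mx : measurable_fun setT (fun z : R * R => z.1) by exact: measurable_fst.
have mh : measurable_fun setT (fun z : R * R => z.2) by exact: measurable_snd.
have mc : measurable_fun setT (fun z : R * R => t) by exact: measurable_cst.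
have mxh : measurable_fun setT (fun z : R * R => z.1 + z.2) by exact: measurable_funD.
have mxh' : measurable_fun setT (fun z : R * R => z.1 - z.2) by exact: measurable_funB.
have mG : measurable_fun setT (fun z : R * R => F (u (z.1, t)) (u (z.1 + z.2, t))).
  exact: mflux (measurable_fun_pair mx mc) (measurable_fun_pair mxh mc).
have mG' : measurable_fun setT (fun z : R * R => F (u (z.1 - z.2, t)) (u (z.1, t))).
  exact: mflux (measurable_fun_pair mxh' mc) (measurable_fun_pair mx mc).
pose H1 (z : R * R) := (p (z.1 + z.2) - p z.1) * F (u (z.1, t)) (u (z.1 + z.2, t)) * k z.2.
pose H2 (z : R * R) := p z.1 *
  (F (u (z.1 - z.2, t)) (u (z.1, t)) - F (u (z.1, t)) (u (z.1 + z.2, t))) * k z.2.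
have mH1 : measurable_fun setT H1.
  apply: measurable_funM; last exact: measurableT_comp mk mh.
  apply: measurable_funM mG; apply: measurable_funB.
    exact: measurableT_comp mp mxh.
  exact: measurableT_comp mp mx.
have mH2 : measurable_fun setT H2.
  apply: measurable_funM; last exact: measurableT_comp mk mh.
  apply: measurable_funM; first exact: measurableT_comp mp mx.
  exact: measurable_funB.
have out x h : k h != 0 -> \1_(`[- (N + delta), N + delta]) x = 0 :> R ->
    p x = 0 /\ p (x + h) = 0.
  move=> kh; rewrite indicE; case: (boolP (_ \in _)); first by move=> _ /eqP; rewrite oner_eq0.
  rewrite notin_setE /= in_itv /= => /negP xN _.
  have /andP[h0 hd] : 0 <= h <= delta.
    by apply: contraNT kh => /k_supp ->.
  have xN' : N + delta < `|x| by rewrite ltNge ler_norml.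
  split; apply: pN; first by rewrite (le_lt_trans _ xN')// lerDl.
  rewrite -(ltrD2r delta) (lt_le_trans xN')//.
  rewrite (le_trans _ (lerD (lexx _) hd))// -{2}(ger0_norm h0).
  by rewrite -{1}(addrK h x) (le_trans (ler_normB _ _)).
have H1a x h : `|H1 (x, h)| <= a x * k h.
  rewrite /H1 /a /=; have [->|kh] := eqVneq (k h) 0; first by rewrite !mulr0 normr0.
  rewrite normrM (ger0_norm (k_ge0 h)) ler_wpM2r//.
  have [/(out _ _ kh)[-> ->]|x1] := eqVneq (\1_(`[- (N + delta), N + delta]) x : R) 0.
    by rewrite subrr mul0r normr0 mulr_ge0// mulr_ge0// mulrn_wge0.
  have -> : \1_(`[- (N + delta), N + delta]) x = 1 :> R.
    by move: x1; rewrite indicE; case: (_ \in _); rewrite //= eqxx.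
  rewrite mulr1 normrM ler_pM//; apply: le_trans (ler_normB _ _) _.
  by rewrite mulr2n lerD.
have H2a x h : `|H2 (x, h)| <= a x * k h.
  rewrite /H2 /a /=; have [->|kh] := eqVneq (k h) 0; first by rewrite !mulr0 normr0.
  rewrite normrM (ger0_norm (k_ge0 h)) ler_wpM2r//.
  have [/(out _ _ kh)[-> _]|x1] := eqVneq (\1_(`[- (N + delta), N + delta]) x : R) 0.
    by rewrite mul0r normr0 mulr_ge0// mulr_ge0// mulrn_wge0.
  have -> : \1_(`[- (N + delta), N + delta]) x = 1 :> R.
    by move: x1; rewrite indicE; case: (_ \in _); rewrite //= eqxx.
  rewrite mulr1 normrM mulrnAl -mulrnAr ler_pM//; apply: le_trans (ler_normB _ _) _.
  by rewrite mulr2n lerD.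
transitivity (\int[mu]_x \int[mu]_h H1 (x, h))%R; first by [].
transitivity (\int[mu]_x \int[mu]_h H2 (x, h))%R.
  rewrite (@Rintegral_Fubini _ _ _ _ R mu mu H1 _ _ mH1 ia ik H1a).
  rewrite (@Rintegral_Fubini _ _ _ _ R mu mu H2 _ _ mH2 ia ik H2a).
  apply: eq_Rintegral => h _.
  pose b x : R := C * BF * \1_(`[- N, N]) x.
  have ib : mu.-integrable setT (EFin \o b) by exact: integrable_scaled_indic.
  have pb x v : `|v| <= BF -> `|p x * v| <= b x.
    move=> vB; rewrite /b indicE; case: (boolP (- N <= x <= N)) => xN.
      by rewrite mem_set ?mulr1//= ?in_itv// normrM ler_pM.
    rewrite pN ?mul0r ?normr0 ?mulr_ge0// ltNge ler_norml; exact: xN.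
  have if1 : mu.-integrable setT (EFin \o (fun x => p x * F (u (x - h, t)) (u (x, t)))).
    apply: dominated_integrable ib; last by move=> x; exact: pb.
    apply: measurable_funM => //.
    exact: measurableT_comp mG' (measurable_pair2 h).
  have if2 : mu.-integrable setT (EFin \o (fun x => p x * F (u (x, t)) (u (x + h, t)))).
    apply: dominated_integrable ib; last by move=> x; exact: pb.
    apply: measurable_funM => //.
    exact: measurableT_comp mG (measurable_pair2 h).
  have [tr if1h] := Rintegral_translation h if1.
  rewrite /H1 /H2 /=.
  transitivity (\int[mu]_x ((p (x + h) * F (u (x + h - h, t)) (u (x + h, t)) -
      p x * F (u (x, t)) (u (x + h, t))) * k h))%R.
    by apply: eq_Rintegral => x _; rewrite addrK; ring.
  rewrite (RintegralZr _ measurableT (integrable_subr measurableT if1h if2)).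
  rewrite (RintegralB measurableT if1h if2) tr -(RintegralB measurableT if1 if2).
  rewrite -(RintegralZr _ measurableT (integrable_subr measurableT if1 if2)).
  by apply: eq_Rintegral => x _; rewrite mulrBr.
pose b x : R := C * ((\int[mu]_h k h)%R * (BF *+ 2)) * \1_(`[- N, N]) x.
have ib : mu.-integrable setT (EFin \o b) by exact: integrable_scaled_indic.
have ipA : mu.-integrable setT (EFin \o (fun x => p x * nonlocal_flux (x, t))).
  apply: dominated_integrable ib.
    apply: measurable_funM => //.
    exact: measurableT_comp measurable_nonlocal_flux (measurable_pair2 t).
  move=> x; rewrite /b indicE; case: (boolP (- N <= x <= N)) => xN.
    by rewrite mem_set ?mulr1//= ?in_itv// normrM ler_pM// nonlocal_flux_bound.
  rewrite pN ?mul0r ?normr0; last by rewrite ltNge ler_norml.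
  rewrite mulr_ge0// mulr_ge0// mulr_ge0 ?mulrn_wge0//.
  exact: Rintegral_ge0.
rewrite -mulN1r -(RintegralZl _ measurableT ipA); apply: eq_Rintegral => x _.
rewrite mulrA /nonlocal_flux /= -(RintegralZl _ measurableT (integrable_nonlocal_integrand (x, t))).
by apply: eq_Rintegral => h _; rewrite /H2 /=; ring.
Qed.

End NonlocalFlux.

Section WeakForm.
Context {R : realType}.
Local Notation mu := (@lebesgue_measure R).

Definition weighted_kernel (delta : R) (w : R -> R) : R -> R :=
  (fun h => w h / h) \_ `[0, delta].

Section kernel.
Variables (delta : R) (w : R -> R).
Hypotheses (w_kernel : is_kernel delta w)
  (w_div_h : (\int[leb]_(h in `[0%R, delta]) (w h / h)%:E < +oo)%E).

Lemma weighted_kernel_ge0 h : 0 <= weighted_kernel delta w h.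
Proof.
have [_ w0 _ _] := w_kernel; rewrite /weighted_kernel patchE; case: ifPn => //.
by rewrite inE /= in_itv/= => /andP[h0 _]; rewrite divr_ge0.
Qed.

Lemma weighted_kernel_supp h : ~~ (0 <= h <= delta) -> weighted_kernel delta w h = 0.
Proof.
by move=> hd; rewrite /weighted_kernel patchE memNset//= in_itv/=; exact/negP.
Qed.

Lemma integrable_weighted_kernel :
  mu.-integrable setT (EFin \o weighted_kernel delta w).
Proof.
have [iw w0 _ _] := w_kernel.
have mw : measurable_fun setT w by apply/measurable_EFinP; exact: measurable_int iw.
have mk : measurable_fun setT (weighted_kernel delta w).
  apply: measurable_patch; first exact: measurable_itv.
  by apply: measurable_funM => //; exact: measurable_inv.
apply/integrableP; split; first exact/measurable_EFinP.
apply: le_lt_trans w_div_h; rewrite [leRHS]integral_mkcond le_eqVlt; apply/orP; left.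
apply/eqP; apply: eq_integral => h _ /=.
by rewrite ger0_norm ?weighted_kernel_ge0// /weighted_kernel !patchE; case: ifP.
Qed.

End kernel.

Section form.
Variables (T delta M BF : R) (w u0 eta : R -> R) (F : R -> R -> R) (u phi : R * R -> R).
Local Notation k := (weighted_kernel delta w).
Hypotheses (delta_gt0 : 0 < delta)
  (w_kernel : is_kernel delta w)
  (w_div_h : (\int[leb]_(h in `[0%R, delta]) (w h / h)%:E < +oo)%E)
  (phiT : test_function T phi)
  (mF : measurable_fun setT (fun z : R * R => F z.1 z.2))
  (mu_ : measurable_fun setT u) (FB : forall z z', `|F (u z) (u z')| <= BF)
  (meta : measurable_fun setT eta) (etaM : forall z, `|eta (u z)| <= M)
  (mu0 : measurable_fun setT u0) (eta0M : forall x, `|eta (u0 x)| <= M).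
Local Notation A := (nonlocal_flux k F u).

Let ik := integrable_weighted_kernel w_kernel w_div_h.
Let k0 := weighted_kernel_ge0 w_kernel.
Let ks := @weighted_kernel_supp delta w.

(** Fubini puts the time integrals inside, and summation by parts moves the
    difference operator from phi to the flux.  Integrability in x of the slices
    is recorded too, since inequalities between slices will be integrated. *)
Lemma weak_form_slices :
  mu.-integrable setT (EFin \o (fun x =>
    \int[mu]_(t in `]0, T[) (eta (u (x, t)) * dt phi (x, t)) +
    eta (u0 x) * phi (x, 0) - \int[mu]_(t in `]0, T[) (phi (x, t) * A (x, t)))%R) /\
  weak_form T delta w u0 eta F u phi =
  (\int[mu]_x (\int[mu]_(t in `]0, T[) (eta (u (x, t)) * dt phi (x, t)) +
    eta (u0 x) * phi (x, 0) - \int[mu]_(t in `]0, T[) (phi (x, t) * A (x, t))))%R.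
Proof.
have [N [C [N0 phiC dtC phiN]]] := test_function_bounds phiT.
have mphi := continuous2_measurable (test_function_continuous phiT).
have mdt := continuous2_measurable (test_function_dt_continuous phiT).
have C0 : 0 <= C by exact: le_trans (phiC (0, 0)).
have M0 : 0 <= M by exact: le_trans (eta0M 0).
have mA := measurable_nonlocal_flux ik mF mu_.
have AB := nonlocal_flux_bound ik k0 mF mu_ FB.
set BA := (\int[mu]_h k h * (BF *+ 2))%R in AB.
have BA0 : 0 <= BA by exact: le_trans (AB (0, 0)).
pose b (c : R) x : R := c * \1_(`[- N, N]) x.
have ib c : mu.-integrable setT (EFin \o b c) by exact: integrable_scaled_indic.
have bP (c d : R) x (p v : R) : 0 <= c -> 0 <= d -> `|v| <= d -> `|p| <= c ->
    (N < `|x| -> p = 0) -> `|p * v| <= b (c * d) x.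
  move=> c0 d0 vd pc pN; rewrite /b indicE; case: (boolP (- N <= x <= N)) => xN.
    by rewrite mem_set ?mulr1//= ?in_itv// normrM ler_pM.
  by rewrite pN ?mul0r ?normr0 ?mulr_ge0// ltNge ler_norml.
pose f1 z := eta (u z) * dt phi z.
have mf1 : measurable_fun setT f1.
  exact: measurable_funM (measurableT_comp meta mu_) mdt.
have f1b x t : `|f1 (x, t)| <= b (C * M) x.
  by rewrite /f1 mulrC; apply: bP => // xN; have [] := phiN (x, t) xN.
pose f3 z := phi z * A z.
have mf3 : measurable_fun setT f3 by exact: measurable_funM.
have f3b x t : `|f3 (x, t)| <= b (C * BA) x.
  by apply: bP => // xN; have [] := phiN (x, t) xN.
have i1 := integrable_slab T mf1 (ib _) f1b.
have i3 := integrable_slab T mf3 (ib _) f3b.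
have i2 : mu.-integrable setT (EFin \o (fun x => eta (u0 x) * phi (x, 0))).
  apply: dominated_integrable (ib (C * M)).
    apply: measurable_funM; first exact: measurableT_comp meta mu0.
    exact: measurableT_comp mphi (measurable_pair2 (0 : R)).
  by move=> x; rewrite mulrC; apply: bP => // xN; have [] := phiN (x, 0) xN.
have i12 := integrable_addr measurableT i1 i2.
split; first exact: (integrable_subr measurableT i12 i3).
rewrite (RintegralB measurableT i12 i3) (RintegralD measurableT i1 i2).
rewrite -(Fubini_slab T mf1 (ib _) f1b) -(Fubini_slab T mf3 (ib _) f3b).
rewrite /weak_form /leb; congr (_ + _ + _).
have ir : mu.-integrable `]0, T[ (EFin \o (fun t => \int[mu]_x f3 (x, t))%R).
  exact: integrable_slab_fst mf3 (ib _) f3b.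
have mD : measurable (`]0, T[%classic : set (measurableTypeR R)) by exact: measurable_itv.
rewrite -mulN1r -(RintegralZl _ mD ir).
apply: eq_Rintegral => t _; rewrite mulN1r.
rewrite -(Rintegral_by_parts_nonlocal ik k0 ks mF mu_ FB t (N := N) (C := C)
  (p := fun x => phi (x, t))).
- apply: eq_Rintegral => x _; rewrite Rintegral_mkcond; apply: eq_Rintegral => h _.
  rewrite /weighted_kernel !patchE /tau /=; case: ifP => _; last by rewrite mulr0.
  by ring.
- exact: measurableT_comp mphi (measurable_pair2 t).
- by move=> x; exact: phiC.
- by move=> x xN; have [] := phiN (x, t) xN.
- exact: ltW.
Qed.

End form.
End WeakForm.

(** * Functions orthogonal to all rectangles of the strip *)

(** The sets on which f has zero integral form a Dynkin system (the induced charge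
    of f is additive), hence contain the sigma-algebra generated by the
    intersection-stable family G; a function whose integrals all vanish is zero
    almost everywhere. *)
Lemma integral_pi_system_eq0 d (X : measurableType d) (R : realType)
    (m : {measure set X -> \bar R}) (G : set (set X)) (f : X -> R) :
  measurable = <<s G >> -> setI_closed G ->
  m.-integrable setT (EFin \o f) ->
  (\int[m]_x (f x)%:E = 0)%E ->
  (forall E, G E -> (\int[m]_(x in E) (f x)%:E = 0)%E) ->
  {ae m, forall x, f x = 0}.
Proof.
move=> mG GI fi f0 fG.
pose P (E : set X) := measurable E /\ (\int[m]_(x in E) (f x)%:E = 0)%E.
have dP : dynkin P.
  split.
  - by split.
  - move=> A [mA A0]; split; first exact: measurableC.
    have := @integral_setU_EFin _ _ _ m A (~` A) f mA (measurableC mA).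
    rewrite setUv f0 A0 add0e => -> //.
      by apply/measurable_EFinP; exact: measurable_int fi.
    by apply/disj_setPS => x [].
  - move=> F tF PF; have mF k : measurable (F k) by have [] := PF k.
    split; first exact: bigcupT_measurable.
    have nuF := @charge_semi_sigma_additive _ _ _
      (induced_charge fi : {charge set X -> \bar R}) F mF tF
      (bigcupT_measurable _ mF).
    apply: (cvg_unique _ nuF) => //.
    rewrite (_ : (fun n => _) = cst 0%E); first exact: cvg_cst.
    by apply/funext => n; rewrite big1// => k _; have [_] := PF k.
have PT : <<s G >> `<=` P.
  apply: (lambda_system_subset GI); first exact/dynkin_lambda_system.
    by move=> E GE; split; [rewrite mG; exact: sub_sigma_algebra|exact: fG].
  by move=> E _; exact: subsetT.
have := @integral_ae_eq _ _ _ m setT measurableT (cst 0%E) (EFin \o f) fi.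
move=> /(_ (measurable_cst _)) ae0.
apply: filterS (ae0 _) => [x /(_ I) /= [->]//|E _ mE].
by rewrite integral0; have [|_ ->//] := PT E; rewrite -mG.
Qed.

Section Rectangles.
Context {R : realType}.
Local Notation mu := (@lebesgue_measure R).

Definition open_rectangles : set (set (R * R)) :=
  [set `]p.1.1, p.1.2[%classic `*` `]p.2.1, p.2.2[%classic | p in [set: (R * R) * (R * R)]].

Lemma open_rectangles_setI : setI_closed open_rectangles.
Proof.
move=> _ _ [[[a b] [c d]] _ <-] [[[a' b'] [c' d']] _ <-] /=.
exists ((Num.max a a', Num.min b b'), (Num.max c c', Num.min d d')) => //=.
apply/seteqP; split => [[x y]|[x y]] /=; rewrite !in_itv/= !gt_max !lt_min.
  by move=> [/andP[/andP[-> ->] /andP[-> ->]] /andP[/andP[-> ->] /andP[-> ->]]].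
by move=> [[/andP[-> ->] /andP[-> ->]] [/andP[-> ->] /andP[-> ->]]].
Qed.

Lemma itv_oo_cover (x : R) : exists n : nat, - n%:R < x < n%:R.
Proof.
near \oo => n; exists n; rewrite -ltr_norml; near: n; exact: nbhs_infty_gtr.
Unshelve. all: by end_near. Qed.

(** Both projections are measurable for the sigma-algebra generated by bounded open
    rectangles, since a vertical or horizontal strip is a countable union of
    them. *)
Lemma measurable_open_rectangles :
  (measurable : set (set (measurableTypeR R * measurableTypeR R))) = <<s open_rectangles >>.
Proof.
pose G2 := g_sigma_algebraType open_rectangles.
have m1 : measurable_fun setT (fst : G2 -> measurableTypeR R).
  apply: (measurability _ (RGenOpens.measurableE R)) => // _ [_ [a [b ->]] <-].
  rewrite setTI (_ : _ @^-1` _ = \bigcup_n (`]a, b[ `*` `](- n%:R), n%:R[)).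
    by apply: bigcupT_measurable => n; apply: sub_sigma_algebra; exists ((a, b), (- n%:R, n%:R)).
  apply/seteqP; split => [[x y] xab|[x y] [n _ []]//].
  by have [n yn] := itv_oo_cover y; exists n => //; split => //=; rewrite in_itv.
have m2 : measurable_fun setT (snd : G2 -> measurableTypeR R).
  apply: (measurability _ (RGenOpens.measurableE R)) => // _ [_ [a [b ->]] <-].
  rewrite setTI (_ : _ @^-1` _ = \bigcup_n (`](- n%:R), n%:R[ `*` `]a, b[)).
    by apply: bigcupT_measurable => n; apply: sub_sigma_algebra; exists ((- n%:R, n%:R), (a, b)).
  apply/seteqP; split => [[x y] xab|[x y] [n _ []]//].
  by have [n xn] := itv_oo_cover x; exists n => //; split => //=; rewrite in_itv.
apply/seteqP; split; last first.
  apply: smallest_sub; first exact: sigma_algebra_measurable.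
  move=> _ [p _ <-]; apply: measurableX; exact: measurable_itv.
rewrite measurable_prod_measurableType; apply: smallest_sub.
  exact: smallest_sigma_algebra.
move=> _ [A mA [B mB <-]].
have -> : A `*` B = (setT `&` fst @^-1` A) `&` (setT `&` snd @^-1` B).
  by rewrite !setTI; apply/seteqP; split => [[x y] []|[x y] []].
exact: (@measurableI _ G2 _ _ (m1 measurableT A mA) (m2 measurableT B mB)).
Qed.

End Rectangles.

Section StripVanishing.
Context {R : realType}.
Local Notation mu := (@lebesgue_measure R).

Definition rectangle_indic (c d a b : R) (z : R * R) : R :=
  \1_(`]c, d[) z.1 * \1_(`]a, b[) z.2.

Lemma rectangle_indicE c d a b z :
  rectangle_indic c d a b z = ((c < z.1 < d) && (a < z.2 < b))%:R.
Proof.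
rewrite /rectangle_indic !indicE !mem_setE !in_itv/=.
by case: (_ && _); rewrite ?mul1r ?mul0r.
Qed.

Lemma rectangle_indic_capI c d a b c' d' a' b' z :
  rectangle_indic c d a b z * rectangle_indic c' d' a' b' z =
  rectangle_indic (Num.max c c') (Num.min d d') (Num.max a a') (Num.min b b') z.
Proof.
rewrite !rectangle_indicE -natrM mulnb !gt_max !lt_min; congr (nat_of_bool _)%:R.
by case: (c < z.1); case: (z.1 < d); case: (c' < z.1); case: (z.1 < d'); case: (a < z.2);
  case: (z.2 < b); case: (a' < z.2); case: (z.2 < b').
Qed.

Lemma integrable_rectangle_indic c d a b :
  (mu \x mu)%E.-integrable setT (EFin \o rectangle_indic c d a b).
Proof.
exact: (@integrable_tensor _ _ _ _ R mu mu _ _ (integrable_indic_itv c d false true)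
  (integrable_indic_itv a b false true)).
Qed.

Lemma measurable_rectangle_indic c d a b :
  measurable_fun setT (rectangle_indic c d a b).
Proof.
apply/measurable_EFinP; exact: measurable_int (integrable_rectangle_indic c d a b).
Qed.

(** The hypothesis covers only rectangles staying away from times 0 and T, because
    the test functions at hand are products of bumps in the open strip.  On the
    slightly smaller rectangle ]-n, n[ x ]e_n, T - e_n[ the function D has zero
    integral over every open rectangle, hence vanishes there; these rectangles
    exhaust the strip. *)
Lemma ae_eq0_strip (T M : R) (D : R * R -> R) : 0 < T -> measurable_fun setT D ->
  (forall z, `|D z| <= M) ->
  (forall c d a b, 0 < a -> a < b -> b < T ->
    (\int[(mu \x mu)%E]_z (D z * rectangle_indic c d a b z) = 0)%R) ->
  {ae (mu \x mu)%E, forall z, strip T z -> D z = 0}.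
Proof.
move=> T0 mD DM D0.
have M0 : 0 <= M by exact: le_trans (DM (0, 0)).
have iD c d a b : (mu \x mu)%E.-integrable setT
    (EFin \o (fun z => D z * rectangle_indic c d a b z)).
  apply: dominated_integrable (integrable_mulr M measurableT (integrable_rectangle_indic c d a b)).
    exact: measurable_funM mD (measurable_rectangle_indic c d a b).
  move=> z; rewrite [leRHS]mulrC normrM ler_pM//.
  by rewrite rectangle_indicE ger0_norm.
have D0' c d a b : 0 < a -> b < T ->
    (\int[(mu \x mu)%E]_z (D z * rectangle_indic c d a b z)%:E = 0)%E.
  move=> a0 bT; have [ab|ba] := ltP a b.
    have := D0 c d a b a0 ab bT; rewrite /Rintegral => E.
    by rewrite -[LHS]fineK ?E//; exact: integrable_fin_num (iD c d a b).
  apply: integral0_eq => z _; rewrite rectangle_indicE.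
  case: (boolP (a < z.2 < b)) => [/andP[az zb]|_]; last by rewrite andbF mulr0.
  by have := lt_le_trans (lt_trans az zb) ba; rewrite ltxx.
pose e n : R := T / n.+3%:R.
have e0 n : 0 < e n by rewrite divr_gt0.
pose f n z := D z * rectangle_indic (- n%:R) n%:R (e n) (T - e n) z.
have aef n : {ae (mu \x mu)%E, forall z, f n z = 0}.
  apply: (integral_pi_system_eq0 measurable_open_rectangles open_rectangles_setI).
  - exact: iD.
  - by apply: D0' => //; rewrite ltrBlDr ltrDl.
  - move=> _ [[[c d] [a b]] _ <-] /=.
    transitivity (\int[(mu \x mu)%E]_z (D z *
        rectangle_indic (Num.max (- n%:R) c) (Num.min n%:R d) (Num.max (e n) a)
          (Num.min (T - e n) b) z)%:E)%E; last first.
      by apply: D0'; rewrite ?lt_max ?e0// gt_min ltrBlDr ltrDl e0.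
    rewrite integral_mkcond; apply: eq_integral.
    move=> z _; rewrite -rectangle_indic_capI mulrA -/(f n z) patchE.
    rewrite [rectangle_indic c d a b z]rectangle_indicE.
    rewrite (_ : (z \in _) = (c < z.1 < d) && (a < z.2 < b)).
      by case: ifP; rewrite ?mulr1 ?mulr0.
    by rewrite in_setX !mem_setE !in_itv.
have : {ae (mu \x mu)%E, forall z, forall n, f n z = 0} by exact/ae_foralln.
apply: filterS; first exact: (ae_filter_ringOfSetsType (mu \x mu)%E).
move=> z fz /andP[z0 zT].
have [n [zn en zTn]] : exists n : nat, [/\ - n%:R < z.1 < n%:R, e n < z.2 & e n < T - z.2].
  near \oo => n; exists n; split.
  - by rewrite -ltr_norml; near: n; exact: nbhs_infty_gtr.
  - rewrite /e ltr_pdivrMr// -ltr_pdivrMl// mulrC (@lt_trans _ _ n%:R)//.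
      by near: n; exact: nbhs_infty_gtr.
    by rewrite ltr_nat -addn3 -[ltnLHS]addn0 ltn_add2l.
  - rewrite /e ltr_pdivrMr// -ltr_pdivrMl ?subr_gt0// mulrC (@lt_trans _ _ n%:R)//.
      by near: n; exact: nbhs_infty_gtr.
    by rewrite ltr_nat -addn3 -[ltnLHS]addn0 ltn_add2l.
have := fz n; rewrite /f rectangle_indicE zn en /= (_ : z.2 < T - e n) ?mulr1//.
by rewrite ltrBrDl -ltrBrDr.
Unshelve. all: by end_near. Qed.

End StripVanishing.

(** * Representation of weak solutions *)

Lemma continuous_pair_snd (R : realType) (x : R) : continuous (fun t : R => (x, t)).
Proof.
move=> t P [[P1 P2] /= [P1x P2t] subP].
by apply: filterS P2t => s P2s; apply: subP; split => //=; exact: nbhs_singleton.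
Qed.

Section Representation.
Context {R : realType}.
Local Notation mu := (@lebesgue_measure R).
Variables (T delta M B : R) (w u0 : R -> R) (g : R -> R -> R) (u : R * R -> R).
Hypotheses (T_gt0 : 0 < T) (delta_gt0 : 0 < delta) (w_kernel : is_kernel delta w)
  (w_div_h : (\int[leb]_(h in `[0%R, delta]) (w h / h)%:E < +oo)%E)
  (mg : measurable_fun setT (fun z : R * R => g z.1 z.2))
  (mu_ : measurable_fun setT u) (uM : forall z, `|u z| <= M)
  (gB : forall z z', `|g (u z) (u z')| <= B)
  (mu0 : measurable_fun setT u0) (u0M : forall x, `|u0 x| <= M).
Local Notation k := (weighted_kernel delta w).
Local Notation A := (nonlocal_flux k g u).

Let ik := integrable_weighted_kernel w_kernel w_div_h.
Let k0 := weighted_kernel_ge0 w_kernel.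

(** Cutting the rate off outside ]0, T[ makes it bounded and compactly supported in
    time, as [ode_solution] requires. *)
Definition flux_on_strip (x t : R) : R := A (x, t) * \1_(`]0, T[) t.

Definition integrated_solution (z : R * R) : R :=
  ode_solution (u0 z.1) (flux_on_strip z.1) z.2.
Local Notation U := integrated_solution.

Definition flux_bound : R := (\int[mu]_h k h * (B *+ 2))%R.
Local Notation BA := flux_bound.

Lemma flux_on_strip_bound x t : `|flux_on_strip x t| <= BA.
Proof.
have AB := nonlocal_flux_bound ik k0 mg mu_ gB (x, t).
rewrite /flux_on_strip indicE; case: (_ \in _); first by rewrite mulr1.
by rewrite mulr0 normr0 (le_trans _ AB).
Qed.

Lemma flux_on_strip_out x t : ~~ (0 < t < T) -> flux_on_strip x t = 0.
Proof.
by move=> tT; rewrite /flux_on_strip indicE memNset ?mulr0//= in_itv/=; exact/negP.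
Qed.

Lemma flux_on_strip_in x t : 0 < t < T -> flux_on_strip x t = A (x, t).
Proof.
by move=> tT; rewrite /flux_on_strip indicE mem_set ?mulr1//= in_itv.
Qed.

Let mA := measurable_nonlocal_flux ik mg mu_.

Let mAs : measurable_fun setT (fun z : R * R => flux_on_strip z.1 z.2).
Proof.
apply: measurable_funM.
  rewrite (_ : (fun _ => _) = A)//; apply/funext => -[x t] //.
apply: (measurableT_comp (f := \1_(`]0, T[) : R -> R)) => //.
Qed.

Lemma measurable_flux_on_strip x : measurable_fun setT (flux_on_strip x).
Proof. exact: measurableT_comp mAs (measurable_pair1 x). Qed.

(** Joint measurability is obtained by writing the integral over ]-oo, t] as an
    integral over the line of a function of (x, t, s). *)
Lemma measurable_integrated_solution : measurable_fun setT U.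
Proof.
rewrite /U /ode_solution.
pose f (y : (R * R) * R) : R :=
  flux_on_strip y.1.1 y.2 * (if y.2 <= y.1.2 then 1 else 0).
have m11 : measurable_fun setT (fun y : (R * R) * R => y.1.1).
  exact: measurableT_comp measurable_fst measurable_fst.
have m12 : measurable_fun setT (fun y : (R * R) * R => y.1.2).
  exact: measurableT_comp measurable_snd measurable_fst.
have m2 : measurable_fun setT (fun y : (R * R) * R => y.2) by exact: measurable_snd.
have mf : measurable_fun setT f.
  apply: measurable_funM; first exact: measurableT_comp mAs (measurable_fun_pair m11 m2).
  by apply: measurable_fun_ifT => //; exact: measurable_fun_ler.
apply: measurable_funB; first exact: measurableT_comp mu0 measurable_fst.
rewrite (_ : (fun _ => _) = (fun z => \int[mu]_s f (z, s))%R).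
  exact: (measurable_Rintegral_snd mu mf).
apply/funext => z; rewrite Rintegral_mkcond; apply: eq_Rintegral => s _.
by rewrite patchE /f mem_setE in_itv/=; case: ifP => _; rewrite ?mulr1 ?mulr0.
Qed.

Lemma integrated_solution_bound z : `|U z| <= M + BA * T.
Proof.
rewrite /U /ode_solution; apply: le_trans (ler_normB _ _) _; apply: lerD => //.
have mD : measurable (`]-oo, z.2] : set (measurableTypeR R)) by exact: measurable_itv.
have iA : mu.-integrable `]-oo, z.2] (EFin \o flux_on_strip z.1).
  apply: (@integrableS _ _ _ mu setT) => //.
  apply: (@bounded_support_integrable _ _ BA 0 T).
  - exact: measurable_flux_on_strip.
  - exact: flux_on_strip_bound.
  - move=> t tT; apply: flux_on_strip_out; apply: contra tT => /andP[t0 tT].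
    by rewrite !ltW.
apply: le_trans (le_normr_Rintegral mD iA) _.
rewrite Rintegral_mkcond.
have -> : BA * T = (\int[mu]_s (BA * \1_(`[0, T]) s))%R.
  rewrite RintegralZl//; last exact: integrable_indic_itv.
  rewrite /Rintegral integral_indic// setIT; congr (_ * _).
  by rewrite [X in fine X]lebesgue_measure_itv/= lte_fin T_gt0 oppr0 addr0.
apply: le_Rintegral => //.
- apply: (@bounded_support_integrable _ _ BA 0 T).
  + apply: measurable_patch => //; apply: measurableT_comp => //.
    exact: measurable_flux_on_strip.
  + move=> t; rewrite patchE; case: ifP => _; first by rewrite normr_id flux_on_strip_bound.
    by rewrite normr0 (le_trans _ (flux_on_strip_bound 0 0)).
  + move=> t tT; rewrite patchE; case: ifP => // _; rewrite flux_on_strip_out ?normr0//.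
    by apply: contra tT => /andP[t0 tT]; rewrite !ltW.
- exact: integrable_scaled_indic.
- move=> s _; rewrite patchE indicE.
  have -> : (s \in (`[0, T]%classic : set R)) = (0 <= s <= T).
    by rewrite mem_setE in_itv.
  have BA0 : 0 <= BA by exact: le_trans (flux_on_strip_bound 0 0).
  case: ifP => _; last by rewrite mulr_ge0.
  have [sT|sT] := boolP (0 <= s <= T); first by rewrite mulr1 flux_on_strip_bound.
  rewrite flux_on_strip_out ?normr0 ?mulr0//.
  by apply: contra sT => /andP[t0 tT]; rewrite !ltW.
Qed.

(** [chain_inequality] on the slice above x.  It is used with eta = id and
    eta = - id, where it yields an identity, and with eta = |. - c|. *)
Lemma slice_chain_inequality (phi : R * R -> R) (x L : R) (eta sigma : R -> R) :
  test_function T phi -> (forall a b, `|eta a - eta b| <= L * `|a - b|) ->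
  measurable_fun setT sigma -> (forall t, `|sigma t| <= 1) ->
  (forall s t, 0 < t < T -> phi (x, t) * (eta (U (x, t)) - eta (U (x, s))) <=
     phi (x, t) * (sigma t * (U (x, t) - U (x, s)))) ->
  (\int[mu]_(t in `]0, T[) (phi (x, t) * sigma t * A (x, t)) <=
   \int[mu]_(t in `]0, T[) (eta (U (x, t)) * dt phi (x, t)) + eta (u0 x) * phi (x, 0))%R.
Proof.
move=> phiT etaL msigma sigma1 sub.
have [N [C [N0 phiC dtC phiN]]] := test_function_bounds phiT.
have Ux0 t : t <= 0 -> U (x, t) = u0 x.
  by move=> t0; rewrite /U (@ode_solution_le0 _ T) => // s; exact: flux_on_strip_out.
have dU := @ode_solution_derivable R T BA (u0 x) (flux_on_strip x)
  (measurable_flux_on_strip x) (flux_on_strip_bound x) (@flux_on_strip_out x).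
have lU := @ode_solution_lipschitz R T BA (u0 x) (flux_on_strip x)
  (measurable_flux_on_strip x) (flux_on_strip_bound x) (@flux_on_strip_out x).
have := @chain_inequality R T BA C L (flux_on_strip x) (fun t => U (x, t))
  (fun t => phi (x, t)) eta sigma.
rewrite (Ux0 0)// => ci.
have -> : (\int[mu]_(t in `]0, T[) (phi (x, t) * sigma t * A (x, t)) =
    \int[mu]_(t in `]0, T[) (phi (x, t) * sigma t * flux_on_strip x t))%R.
  apply: eq_Rintegral => t; rewrite inE/= in_itv/= => tT.
  by rewrite flux_on_strip_in.
apply: ci => //.
- exact: measurable_flux_on_strip.
- exact: flux_on_strip_bound.
- by move=> t; exact: (test_function_derivable phiT).
- move=> t; apply: (continuous_comp (f := fun t => (x, t)) (g := dt phi)).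
    exact: continuous_pair_snd.
  exact: (test_function_dt_continuous phiT).
- by move=> t; exact: (dtC (x, t)).
- move=> t Tt; apply: test_function_eq0.
  exact: (test_function_ge phiT (z := (x, t))).
- move=> t Tt; apply: (test_function_dt_eq0 (z := (x, t))).
  exact: (test_function_ge phiT (z := (x, t))).
- by move=> s t tT _; exact: sub.
Qed.

(** U satisfies on every slice the identity that the weak form of u satisfies after
    integration in x. *)
Lemma slice_identity (phi : R * R -> R) (x : R) : test_function T phi ->
  (\int[mu]_(t in `]0, T[) (U (x, t) * dt phi (x, t)) + u0 x * phi (x, 0) =
   \int[mu]_(t in `]0, T[) (phi (x, t) * A (x, t)))%R.
Proof.
move=> phiT; apply/eqP; rewrite eq_le; apply/andP; split.
  have := @slice_chain_inequality phi x 1 (fun a => - a) (cst (-1)) phiT.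
  have mD : measurable (`]0, T[ : set (measurableTypeR R)) by exact: measurable_itv.
  have [N [C [N0 phiC dtC phiN]]] := test_function_bounds phiT.
  have i1 : mu.-integrable `]0, T[ (EFin \o (fun t => U (x, t) * dt phi (x, t))).
    apply: (@bounded_itv_integrable _ _ ((M + BA * T) * C)).
      apply: measurable_funM.
        exact: measurableT_comp measurable_integrated_solution (measurable_pair1 x).
      apply: (measurableT_comp (continuous2_measurable (test_function_dt_continuous phiT))).
      exact: (measurable_pair1 x).
    by move=> t; rewrite normrM ler_pM// integrated_solution_bound.
  have i2 : mu.-integrable `]0, T[ (EFin \o (fun t => phi (x, t) * A (x, t))).
    apply: (@bounded_itv_integrable _ _ (C * BA)).
      apply: measurable_funM.
        apply: (measurableT_comp (continuous2_measurable (test_function_continuous phiT))).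
        exact: (measurable_pair1 x).
      exact: measurableT_comp mA (measurable_pair1 x).
    move=> t; rewrite normrM ler_pM//.
    exact: (nonlocal_flux_bound ik k0 mg mu_ gB).
  rewrite (@eq_Rintegral _ _ _ mu `]0, T[ (fun t => -1 * (phi (x, t) * A (x, t)))); last first.
    by move=> t _ /=; ring.
  rewrite (@eq_Rintegral _ _ _ mu `]0, T[ (fun t => -1 * (U (x, t) * dt phi (x, t)))
    (fun t => - U (x, t) * dt phi (x, t))); last by move=> t _ /=; ring.
  rewrite (RintegralZl _ mD i1) (RintegralZl _ mD i2) !mulN1r mulNr -opprD lerN2; apply.
  - by move=> a b; rewrite mul1r -[leRHS]normrN opprB opprK addrC.
  - exact: measurable_cst.
  - by move=> t; rewrite /= normrN1.
  - by move=> s t _; rewrite (_ : cst (-1) t * _ = - U (x, t) - - U (x, s))//; rewrite /cst; ring.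
have := @slice_chain_inequality phi x 1 id (cst 1) phiT.
rewrite (@eq_Rintegral _ _ _ mu `]0, T[ (fun t => phi (x, t) * A (x, t))
  (fun t => phi (x, t) * cst 1 t * A (x, t))); last by move=> t _; rewrite /= mulr1.
apply => //.
- by move=> a b; rewrite mul1r.
- by move=> t; rewrite normr1.
- by move=> s t _; rewrite /= mul1r.
Qed.

Hypothesis weak : forall phi, test_function T phi -> weak_form T delta w u0 id g u phi = 0.

Let D (z : R * R) : R := u z - U z.

Let mD : measurable_fun setT D.
Proof. exact: measurable_funB mu_ measurable_integrated_solution. Qed.

Let D_bound z : `|D z| <= M + (M + BA * T).
Proof.
apply: le_trans (ler_normB _ _) _; apply: lerD => //; exact: integrated_solution_bound.
Qed.

(** Subtracting [slice_identity] from the weak form cancels the initial datum and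
    the nonlocal term. *)
Lemma weak_difference (phi : R * R -> R) : test_function T phi ->
  (\int[mu]_x \int[mu]_(t in `]0, T[) (D (x, t) * dt phi (x, t)) = 0)%R.
Proof.
move=> phiT; have [_] := weak_form_slices (eta := id) delta_gt0 w_kernel w_div_h phiT mg mu_ gB
  (@measurable_id _ _ _) uM mu0 u0M.
rewrite (weak phiT) => E; rewrite [RHS]E; apply: eq_Rintegral => x _.
rewrite -(slice_identity x phiT).
have mI : measurable (`]0, T[ : set (measurableTypeR R)) by exact: measurable_itv.
have [N [C [N0 phiC dtC phiN]]] := test_function_bounds phiT.
have mdt : measurable_fun setT (fun t => dt phi (x, t)).
  apply: (measurableT_comp (continuous2_measurable (test_function_dt_continuous phiT))).
  exact: (measurable_pair1 x).
have i1 : mu.-integrable `]0, T[ (EFin \o (fun t => U (x, t) * dt phi (x, t))).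
  apply: (@bounded_itv_integrable _ _ ((M + BA * T) * C)).
    apply: measurable_funM => //.
    exact: measurableT_comp measurable_integrated_solution (measurable_pair1 x).
  by move=> t; rewrite normrM ler_pM// integrated_solution_bound.
have i2 : mu.-integrable `]0, T[ (EFin \o (fun t => u (x, t) * dt phi (x, t))).
  apply: (@bounded_itv_integrable _ _ (M * C)).
    apply: measurable_funM => //.
    exact: measurableT_comp mu_ (measurable_pair1 x).
  by move=> t; rewrite normrM ler_pM.
rewrite opprD addrACA subrr addr0 -(RintegralB mI i2 i1).
by apply: eq_Rintegral => t _; rewrite /D mulrBl.
Qed.

Lemma bump_le_indic (a b : R) n x : `|bump a b n x| <= \1_(`]a, b[) x.
Proof.
rewrite indicE; case: (boolP (a < x < b)) => xab.
  by rewrite mem_set ?bump_norm_le1//= in_itv.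
by rewrite bump_eq0// normr0.
Qed.

(** A bump in time is the derivative of a function vanishing near T, so
    [weak_difference] says that u - U is orthogonal to products of bumps;
    letting these tend to indicators gives orthogonality to rectangles. *)
Lemma weak_solution_integrated : {ae (mu \x mu)%E, forall z, strip T z -> u z = U z}.
Proof.
suff : {ae (mu \x mu)%E, forall z, strip T z -> D z = 0}.
  apply: filterS; first exact: (ae_filter_ringOfSetsType (mu \x mu)%E).
  by move=> z Dz /Dz /eqP; rewrite subr_eq0 => /eqP.
apply: (ae_eq0_strip T_gt0 mD D_bound) => c d a b a0 ab bT.
pose MD := M + (M + BA * T).
have DM z : `|D z| <= MD by exact: D_bound.
have MD0 : 0 <= MD by exact: le_trans (DM (0, 0)).
pose f n (z : R * R) := D z * (bump c d n z.1 * bump a b n z.2).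
have mf n : measurable_fun setT (f n).
  apply: measurable_funM => //; apply: measurable_funM.
    exact: measurableT_comp (measurable_bump c d n) measurable_fst.
  exact: measurableT_comp (measurable_bump a b n) measurable_snd.
have fa n x t : `|f n (x, t)| <= MD * \1_(`[c, d]) x.
  rewrite /f /= normrM ler_pM// normrM -[leRHS]mulr1 ler_pM ?bump_norm_le1//.
  apply: le_trans (bump_le_indic _ _ _ _) _; rewrite !indicE.
  have [|//] := boolP (x \in `]c, d[%classic); rewrite inE/= in_itv/= => /andP[cx xd].
  by rewrite mem_set//= in_itv/= !ltW.
have int0 n : (\int[(mu \x mu)%E]_z (f n z * \1_(`]0, T[) z.2) = 0)%R.
  rewrite -(Rintegral_slab_prod T (mf n) (integrable_scaled_indic _ _ _) (fa n)).
  have [beta [sbeta dbeta beta0]] := supported_antiderivative a0 ab bT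
    (smooth1_bump a b n) (@bump_eq0 _ a b n) (integrable_bump a b n).
  pose phi (z : R * R) := bump c d n z.1 * beta z.2.
  have phiT : test_function T phi.
    apply: (test_function_tensor (a := c) (b := d) (c := - T) (d := b)) => //.
      exact: smooth1_bump.
    move=> x xcd; apply: bump_eq0; apply: contra xcd => /andP[cx xd].
    by rewrite !ltW.
  rewrite -[RHS](weak_difference phiT); apply: eq_Rintegral => x _; apply: eq_Rintegral => t.
  rewrite inE/= in_itv/= => /andP[t0 _]; congr (_ * _).
  rewrite /dt /phi /= derive1E.
  have db := is_deriveZ (bump c d n x) (derivable_is_derive1 (smooth1_derivable sbeta) t).
  by rewrite (derive_val (is_derive := db)) dbeta.
have m1 : measurable_fun setT (fun z : R * R => \1_(`]0, T[) z.2 : R).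
  by apply: (measurableT_comp (f := \1_(`]0, T[) : R -> R)).
have : (\int[(mu \x mu)%E]_z (f n z * \1_(`]0, T[) z.2))%R @[n --> \oo] -->
    (\int[(mu \x mu)%E]_z (D z * rectangle_indic c d a b z))%R.
  apply: (@dominated_cvg_Rintegral _ _ _ (mu \x mu)%E
    (fun n z => f n z * \1_(`]0, T[) z.2) (fun z => D z * rectangle_indic c d a b z)
    (fun z => rectangle_indic c d a b z * MD)).
  - by move=> n; exact: measurable_funM (mf n) m1.
  - exact: measurable_funM mD (measurable_rectangle_indic c d a b).
  - exact: (integrable_mulr MD measurableT (integrable_rectangle_indic c d a b)).
  - move=> n z; rewrite /f normrM normrM [leRHS]mulrC -mulrA ler_pM//.
    rewrite -[leRHS]mulr1 ler_pM//; last by rewrite indicE; case: (_ \in _); rewrite ?normr1 ?normr0.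
    by rewrite normrM /rectangle_indic ler_pM// bump_le_indic.
  - apply: aeW => z; rewrite /f.
    have -> : rectangle_indic c d a b z = rectangle_indic c d a b z * \1_(`]0, T[) z.2.
      rewrite rectangle_indicE; case: (boolP (_ && _)) => [/andP[_ /andP[az zb]]|_]; last by rewrite mul0r.
      by rewrite indicE mem_set ?mulr1//= in_itv/= (lt_trans a0 az) (lt_trans zb bT).
    rewrite mulrA; apply: cvgM; last exact: cvg_cst.
    by apply: cvgM; [exact: cvg_cst|apply: cvgM; exact: bump_cvg_indic].
rewrite (_ : (fun n => _) = cst 0) => [h|]; last by apply/funext.
by apply/esym; apply: (cvg_unique _ _ h); [exact: Rhausdorff|exact: cvg_cst].
Qed.

End Representation.

(** * The entropy inequality *)

Section Flux.
Context {R : realType}.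
Variables (g : R -> R -> R).

Lemma lipschitz_flux_measurable : lipschitz_flux g ->
  measurable_fun setT (fun z : R * R => g z.1 z.2).
Proof.
move=> [C gC]; apply: continuous2_measurable => -[a b].
apply/cvgrPdist_lt => e e0.
have C1 : 0 < `|C| + 1 by rewrite ltr_wpDl.
have d0 : 0 < e / (`|C| + 1) / 2 by rewrite !divr_gt0.
near=> z; apply: le_lt_trans (gC _ _ _ _) _.
apply: (@le_lt_trans _ _ ((`|C| + 1) * (`|a - z.1| + `|b - z.2|))).
  by rewrite ler_wpM2r ?addr_ge0// (le_trans (ler_norm _))// lerDl.
rewrite mulrC -ltr_pdivlMr// (splitr (e / _)); apply: ltrD; near: z.
  by apply: (@cvgr_dist_lt _ _ _ (nbhs (a, b)) _ fst a cvg_fst).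
by apply: (@cvgr_dist_lt _ _ _ (nbhs (a, b)) _ snd b cvg_snd).
Unshelve. all: by end_near. Qed.

Lemma lipschitz_flux_bound (M : R) : lipschitz_flux g ->
  exists B, forall a b, `|a| <= M -> `|b| <= M -> `|g a b| <= B.
Proof.
move=> [C gC]; exists (`|g 0 0| + `|C| * (M + M)) => a b aM bM.
have := gC a b 0 0; rewrite !subr0 => gab.
rewrite -[g a b](subrK (g 0 0)) (le_trans (ler_normD _ _))// addrC lerD2l.
apply: le_trans gab _; apply: (@le_trans _ _ (`|C| * (`|a| + `|b|))).
  by rewrite ler_wpM2r ?addr_ge0// ler_norm.
by rewrite ler_wpM2l// lerD.
Qed.

Lemma measurable_entropy_flux c : lipschitz_flux g ->
  measurable_fun setT (fun z : R * R => entropy_flux g z.1 z.2 c).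
Proof.
move=> /lipschitz_flux_measurable mg.
have m1 : measurable_fun setT (fun z : R * R => Num.max z.1 c).
  by apply: measurable_maxr => //; exact: measurable_fst.
have m2 : measurable_fun setT (fun z : R * R => Num.max z.2 c).
  by apply: measurable_maxr => //; exact: measurable_snd.
have n1 : measurable_fun setT (fun z : R * R => Num.min z.1 c).
  by apply: measurable_minr => //; exact: measurable_fst.
have n2 : measurable_fun setT (fun z : R * R => Num.min z.2 c).
  by apply: measurable_minr => //; exact: measurable_snd.
have := measurable_funB (measurableT_comp mg (measurable_fun_pair m1 m2))
  (measurableT_comp mg (measurable_fun_pair n1 n2)).
exact.
Qed.

Lemma entropy_flux_bound (M c : R) : lipschitz_flux g ->
  exists B, forall a b, `|a| <= M -> `|b| <= M -> `|entropy_flux g a b c| <= B.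
Proof.
move=> /(lipschitz_flux_bound (Num.max M `|c|))[B gB].
have mB x : `|x| <= M -> `|Num.max x c| <= Num.max M `|c|.
  by move=> xM; rewrite le_max; have [_|_] := leP x c; rewrite ?xM ?lexx ?orbT.
have nB x : `|x| <= M -> `|Num.min x c| <= Num.max M `|c|.
  by move=> xM; rewrite le_max; have [_|_] := leP x c; rewrite ?xM ?lexx ?orbT.
exists (B + B) => a b aM bM; apply: le_trans (ler_normB _ _) _.
by apply: lerD; apply: gB; rewrite ?mB ?nB.
Qed.

(** Kato's inequality for the numerical flux.  If c <= a, then
    q(a,b;c) <= g(a,b) - g(c,c) and q(z,a;c) >= g(z,a) - g(c,c): according to the
    position of b, resp. z, with respect to c, each is an equality or a
    consequence of monotonicity.  The case a < c is symmetric. *)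
Lemma entropy_flux_difference_le (a b z c : R) : monotone_flux g ->
  entropy_flux g a b c - entropy_flux g z a c <=
  (if c <= a then 1 else -1) * (g a b - g z a).
Proof.
move=> [g1 g2]; rewrite /entropy_flux.
have [ca|/ltW ac] := leP c a.
  rewrite mul1r.
  have h1 : g a (Num.max b c) - g c (Num.min b c) <= g a b - g c c.
    have [bc|/ltW cb] := leP b c => //.
    by apply: lerB; [exact: g2|exact: g2].
  have h2 : - (g (Num.max z c) a - g (Num.min z c) c) <= - g z a + g c c.
    rewrite opprB addrC; have [zc|/ltW cz] := leP z c => //.
    by apply: lerD; [rewrite lerN2; exact: g1|exact: g1].
  by have := lerD h1 h2; lra.
rewrite mulN1r.
have h1 : g c (Num.max b c) - g a (Num.min b c) <= g c c - g a b.
  have [bc|/ltW cb] := leP b c => //.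
  by apply: lerB; exact: g2.
have h2 : - (g (Num.max z c) c - g (Num.min z c) a) <= - g c c + g z a.
  rewrite opprB addrC; have [zc|/ltW cz] := leP z c => //.
  by apply: lerD; [rewrite lerN2; exact: g1|exact: g1].
by have := lerD h1 h2; lra.
Qed.

End Flux.

Section Entropy.
Context {R : realType}.
Local Notation mu := (@lebesgue_measure R).
Variables (T delta M : R) (w u0 : R -> R) (g : R -> R -> R) (u : R * R -> R).
Hypotheses (T_gt0 : 0 < T) (delta_gt0 : 0 < delta) (w_kernel : is_kernel delta w)
  (w_div_h : (\int[leb]_(h in `[0%R, delta]) (w h / h)%:E < +oo)%E)
  (g_monotone : monotone_flux g) (g_lipschitz : lipschitz_flux g)
  (mu_ : measurable_fun setT u) (uM : forall z, `|u z| <= M)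
  (mu0 : measurable_fun setT u0) (u0M : forall x, `|u0 x| <= M)
  (weak : forall phi, test_function T phi -> weak_form T delta w u0 id g u phi = 0).
Local Notation k := (weighted_kernel delta w).

Let ik := integrable_weighted_kernel w_kernel w_div_h.
Let k0 := weighted_kernel_ge0 w_kernel.

(** The slices of the entropy form are compared one by one: the flux term is
    bounded by the sign of U - c times the nonlocal operator of g, and
    [slice_chain_inequality] applies to the convex function |. - c|, whose
    subgradient is that sign.  The representation u = U is used both to replace
    |u - c| by |U - c| and to identify the two signs. *)
Lemma bounded_weak_solution_entropy (c : R) (phi : R * R -> R) :
  test_function T phi ->
  (forall x t : R, 0 <= t < T -> 0 <= phi (x, t)) ->
  0 <= weak_form T delta w u0 (fun a => `|a - c|)
         (fun a b => entropy_flux g a b c) u phi.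
Proof.
move=> phiT phi0.
have mg := lipschitz_flux_measurable g_lipschitz.
have [B gB'] := lipschitz_flux_bound M g_lipschitz.
have gB z z' : `|g (u z) (u z')| <= B by exact: gB'.
have mq := measurable_entropy_flux c g_lipschitz.
have [Bq qB'] := entropy_flux_bound M c g_lipschitz.
have qB z z' : `|entropy_flux g (u z) (u z') c| <= Bq by exact: qB'.
have meta : measurable_fun setT (fun a : R => `|a - c|).
  by apply: measurableT_comp => //; exact: measurable_funB.
have etaM (a : R) : `|a| <= M -> `| `|a - c| | <= M + `|c|.
  by move=> aM; rewrite normr_id (le_trans (ler_normB _ _))// lerD2r.
have etauM z : `| `|u z - c| | <= M + `|c| by exact/etaM/uM.
have etau0M x : `| `|u0 x - c| | <= M + `|c| by exact/etaM/u0M.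
have [iS ->] := @weak_form_slices R T delta (M + `|c|) Bq w u0 (fun a => `|a - c|)
  (fun a b => entropy_flux g a b c) u phi delta_gt0 w_kernel w_div_h phiT mq mu_ qB
  meta etauM mu0 etau0M.
have uU := weak_solution_integrated T_gt0 delta_gt0 w_kernel w_div_h mg mu_ uM gB mu0 u0M weak.
(* It suffices that almost every slice is nonnegative. *)
have I0 : 0 = (\int[mu]_x cst 0 x)%R :> R by rewrite Rintegral_cst ?mul0r.
rewrite [leLHS]I0; apply: le_ae_Rintegral; [exact: integrable0|exact: iS|].
have := @ae_prod_xsection _ _ _ _ R mu mu _ uU.
apply: filterS.
move=> x uUx /=.
set U := integrated_solution T delta w u0 g u in uU uUx *.
rewrite subr_ge0.
(* The subgradient of |. - c| at U(x, t). *)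
pose sigma t : R := if c <= U (x, t) then 1 else -1.
have mU := measurable_integrated_solution T w_kernel w_div_h mg mu_ mu0.
have mUx : measurable_fun setT (fun t => U (x, t)) by exact: measurableT_comp mU (measurable_pair1 x).
have msigma : measurable_fun setT sigma.
  by apply: measurable_fun_ifT => //; exact: measurable_fun_ler.
have sigma1 t : `|sigma t| <= 1.
  by rewrite /sigma; case: ifP => _; rewrite ?normr1 ?normrN1.
have [N [C [N0 phiC dtC phiN]]] := test_function_bounds phiT.
have mD : measurable (`]0, T[ : set (measurableTypeR R)) by exact: measurable_itv.
have mphi : measurable_fun setT (fun t => phi (x, t)).
  apply: (measurableT_comp (continuous2_measurable (test_function_continuous phiT))).
  exact: (measurable_pair1 x).
have mdt : measurable_fun setT (fun t => dt phi (x, t)).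
  apply: (measurableT_comp (continuous2_measurable (test_function_dt_continuous phiT))).
  exact: (measurable_pair1 x).
have chain := @slice_chain_inequality R T delta B w u0 g u T_gt0 w_kernel w_div_h mg mu_
  gB phi x 1 (fun a => `|a - c|) sigma phiT.
pose q a b := entropy_flux g a b c.
have AqC := @nonlocal_flux_bound R Bq k q u ik k0 mq mu_ qB.
have AgC := @nonlocal_flux_bound R B k g u ik k0 mg mu_ gB.
apply: (@le_trans _ _ (\int[mu]_(t in `]0, T[)
    (phi (x, t) * sigma t * nonlocal_flux k g u (x, t)))%R).
  apply: le_ae_Rintegral_in => //.
  - apply: (@bounded_itv_integrable _ _ (C * ((\int[mu]_h k h)%R * (Bq *+ 2)))).
      apply: measurable_funM => //.
      exact: measurableT_comp (@measurable_nonlocal_flux R k q u ik mq mu_) (measurable_pair1 x).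
    by move=> t; rewrite normrM ler_pM.
  - apply: (@bounded_itv_integrable _ _ (C * 1 * ((\int[mu]_h k h)%R * (B *+ 2)))).
      apply: measurable_funM; first exact: measurable_funM.
      exact: measurableT_comp (@measurable_nonlocal_flux R k g u ik mg mu_) (measurable_pair1 x).
    by move=> t; rewrite !normrM ler_pM// ler_pM.
  - apply: filterS uUx.
    move=> t uUt; rewrite /= in_itv/= => tT.
    rewrite -mulrA ler_wpM2l//; first by apply: phi0; case/andP: tT => /ltW -> ->.
    have iq := @integrable_nonlocal_integrand R Bq k q u ik k0 mq mu_ qB (x, t).
    have ig := @integrable_nonlocal_integrand R B k g u ik k0 mg mu_ gB (x, t).
    rewrite /nonlocal_flux -(RintegralZl _ measurableT ig).
    apply: le_Rintegral => //.
      by have := integrable_mulr (sigma t) measurableT ig;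
        apply: eq_integrable => // h _ /=; rewrite mulrC.
    move=> h _; rewrite mulrCA ler_wpM2l//.
    rewrite /sigma -(uUt tT); exact: entropy_flux_difference_le.
rewrite (@ae_eq_Rintegral _ _ _ mu `]0, T[ (fun t => `|u (x, t) - c| * dt phi (x, t))
    (fun t => `|U (x, t) - c| * dt phi (x, t))) //.
- apply: chain => //.
  + by move=> a b; rewrite mul1r (le_trans (ler_dist_dist _ _))// opprB addrA subrK.
  + move=> s t tT; rewrite ler_wpM2l//; first by apply: phi0; case/andP: tT => /ltW -> ->.
    rewrite -/U /sigma; case: (leP c (U (x, t))) => cU.
      by rewrite mul1r ger0_norm ?subr_ge0//; have := ler_norm (U (x, s) - c); lra.
    rewrite mulN1r ltr0_norm ?subr_lt0//.
    by have := ler_norm (- (U (x, s) - c)); rewrite normrN; lra.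
- apply: measurable_funTS; apply: measurable_funM mdt; apply: (measurableT_comp meta).
  exact: measurableT_comp mu_ (measurable_pair1 x).
- by apply: measurable_funTS; apply: measurable_funM mdt; exact: measurableT_comp meta mUx.
- apply: filterS uUx.
  by move=> t uUt; rewrite /= in_itv/= => tT; rewrite uUt.
Qed.

End Entropy.

(** * Uniqueness *)

Section Comparison.
Context {R : realType}.
Local Notation mu := (@lebesgue_measure R).

Lemma is_derive_expR_scaled (lam x : R) :
  is_derive x 1 (fun s => expR (lam * s)) (lam * expR (lam * x)).
Proof.
rewrite [X in is_derive _ _ _ X]mulrC.
have h : is_derive x 1 (fun s : R => lam * s) lam.
  by rewrite -[X in is_derive _ _ _ X]mulr1; exact: (is_deriveZ (f := id)).
exact: (@is_derive1_comp R expR (fun s => lam * s) x (expR (lam * x)) lam).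
Qed.

Lemma Rintegral_expR (lam t : R) : 0 < lam -> 0 < t ->
  (\int[mu]_(s in `]0, t[) expR (lam * s) <= expR (lam * t) / lam)%R.
Proof.
move=> lam0 t0; pose f (s : R) := expR (lam * s) / lam.
have df (x : R) : is_derive x 1 f (expR (lam * x)).
  have -> : f = lam^-1 *: (fun s => expR (lam * s)).
    by apply/funext => s; rewrite /f mulrC.
  have -> : expR (lam * x) = lam^-1 *: (lam * expR (lam * x)).
    by rewrite /GRing.scale/= mulKf// gt_eqF.
  by apply: is_deriveZ; exact: is_derive_expR_scaled.
have f' : derive1 f = fun s => expR (lam * s).
  by apply/funext => s; rewrite derive1E; apply: derive_val.
rewrite -f' (@Rintegral_derive1 _ f)//.
- rewrite /f mulr0 expR0 gerBl mul1r invr_ge0 ltW//.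
- rewrite f' => x; apply: continuous_comp; last exact: continuous_expR.
  exact: mulrl_continuous.
Qed.

(** The exponential weight is reproduced by integration with a gain 1/lam, and this
    gain is what makes the difference of two solutions contract. *)
Lemma ode_solution_distance (U0 T B c lam t : R) (A1 A2 : R -> R) :
  0 < lam -> 0 <= c -> 0 < t -> 
  measurable_fun setT A1 -> measurable_fun setT A2 ->
  (forall s, `|A1 s| <= B) -> (forall s, `|A2 s| <= B) ->
  (forall s, ~~ (0 < s < T) -> A1 s = 0) -> (forall s, ~~ (0 < s < T) -> A2 s = 0) ->
  {ae mu, forall s, 0 < s < T -> `|A1 s - A2 s| <= c * expR (lam * s)} ->
  `|ode_solution U0 A1 t - ode_solution U0 A2 t| <= c / lam * expR (lam * t).
Proof.
move=> lam0 c0 t0 m1 m2 b1 b2 s1 s2 ae12.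
have AI (A : R -> R) : measurable_fun setT A -> (forall s, `|A s| <= B) ->
    (forall s, ~~ (0 < s < T) -> A s = 0) -> mu.-integrable setT (EFin \o A).
  move=> mA bA sA; apply: (@bounded_support_integrable _ _ B 0 T) => // s sT.
  by apply: sA; apply: contra sT => /andP[h1 h2]; rewrite !ltW.
have mD : measurable (`]-oo, t] : set (measurableTypeR R)) by exact: measurable_itv.
have mE : measurable (`]0, t[ : set (measurableTypeR R)) by exact: measurable_itv.
have i1 := integrableS measurableT mD (@subsetT _ _) (AI _ m1 b1 s1).
have i2 := integrableS measurableT mD (@subsetT _ _) (AI _ m2 b2 s2).
have i12 := integrable_subr mD i2 i1.
have -> : ode_solution U0 A1 t - ode_solution U0 A2 t =
    (\int[mu]_(s in `]-oo, t]) (A2 s - A1 s))%R.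
  by rewrite RintegralB// /ode_solution; ring.
apply: le_trans (le_normr_Rintegral mD i12) _.
have iE : mu.-integrable `]0, t[ (EFin \o (fun s => expR (lam * s))).
  rewrite integrable_mkcond// restrict_EFin.
  apply: (@bounded_support_integrable _ _ (expR (lam * t)) 0 t).
  - apply: measurable_patch => //; apply: (measurableT_comp (@measurable_expR R)).
    by apply: measurable_funM.
  - move=> s; rewrite patchE mem_setE in_itv/=; case: ifPn => [/andP[_ /ltW st]|_].
      by rewrite ger0_norm ?expR_ge0// ler_expR ler_pM2l.
    by rewrite -[X in `|X|]/(0 : R) normr0 expR_ge0.
  - move=> s; rewrite patchE mem_setE in_itv/= => h; case: ifPn => // /andP[h1 h2].
    by move: h; rewrite !ltW.
have icE : mu.-integrable `]0, t[ (EFin \o (fun s => c * expR (lam * s))).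
  by apply: eq_integrable (integrable_mulr c mE iE) => // s _ /=; rewrite mulrC.
apply: (@le_trans _ _ (\int[mu]_(s in `]0, t[) (c * expR (lam * s)))%R).
  have i12' : mu.-integrable `]-oo, t[ (EFin \o (fun s => `|A2 s - A1 s|)).
    apply: integrable_norm; apply: integrableS i12 => // s /=.
    by rewrite !in_itv/= => /ltW.
  rewrite -Rintegral_itv_bndo_bndc//.
  rewrite Rintegral_mkcond [leRHS]Rintegral_mkcond.
  apply: le_ae_Rintegral => //.
    by rewrite -restrict_EFin -integrable_mkcond.
    by rewrite -restrict_EFin -integrable_mkcond.
  apply: filterS ae12; first exact: (ae_filter_ringOfSetsType mu).
  move=> s; rewrite !patchE !mem_setE !in_itv/=.
  have [st|st] /= := ltP s t; last by rewrite andbF.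
  rewrite andbT; have [sge0|sle0] := ltP 0 s; last first.
    move=> _; rewrite s1 ?s2 ?subrr ?normr0// ltNge sle0//.
  have [sT h|Ts _] := ltP s T; first by rewrite distrC; exact: h.
  by rewrite s1 ?s2 ?subrr ?normr0 ?mulr_ge0 ?expR_ge0// (ltNge s T) Ts andbF.
rewrite RintegralZl//.
  by rewrite -mulrA ler_wpM2l// mulrC; exact: Rintegral_expR.
Qed.
End Comparison.

Section Uniqueness.
Context {R : realType}.
Local Notation mu := (@lebesgue_measure R).
Variables (T delta M B C : R) (w u0 : R -> R) (g : R -> R -> R) (u v : R * R -> R).
Hypotheses (w_kernel : is_kernel delta w)
  (w_div_h : (\int[leb]_(h in `[0%R, delta]) (w h / h)%:E < +oo)%E)
  (mg : measurable_fun setT (fun z : R * R => g z.1 z.2))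
  (C_ge0 : 0 <= C)
  (gC : forall a1 b1 a2 b2, `|g a1 b1 - g a2 b2| <= C * (`|a1 - a2| + `|b1 - b2|))
  (mu_ : measurable_fun setT u) (uM : forall z, `|u z| <= M)
  (uB : forall z z', `|g (u z) (u z')| <= B)
  (mv : measurable_fun setT v) (vM : forall z, `|v z| <= M)
  (vB : forall z z', `|g (v z) (v z')| <= B)
  (uU : {ae (mu \x mu)%E, forall z, strip T z -> u z = integrated_solution T delta w u0 g u z})
  (vV : {ae (mu \x mu)%E, forall z, strip T z -> v z = integrated_solution T delta w u0 g v z}).
Local Notation k := (weighted_kernel delta w).
Local Notation K := (\int[mu]_h k h)%R.

Let ik := integrable_weighted_kernel w_kernel w_div_h.
Let k0 := weighted_kernel_ge0 w_kernel.

Let K_ge0 : 0 <= K.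
Proof. by apply: Rintegral_ge0 => h _; exact: k0. Qed.

(** Each of the two values of g differs by at most C (e + e).  The hypotheses on
    the translates are only almost everywhere in h, which is all the integral
    sees. *)
Lemma nonlocal_flux_distance (z : R * R) (e : R) : `|u z - v z| <= e ->
  {ae mu, forall h, `|u (z.1 + h, z.2) - v (z.1 + h, z.2)| <= e} ->
  {ae mu, forall h, `|u (z.1 - h, z.2) - v (z.1 - h, z.2)| <= e} ->
  `|nonlocal_flux k g u z - nonlocal_flux k g v z| <= 4 * C * K * e.
Proof.
move=> ez er el.
have iu := @integrable_nonlocal_integrand R B k g u ik k0 mg mu_ uB z.
have iv := @integrable_nonlocal_integrand R B k g v ik k0 mg mv vB z.
have iuv := integrable_subr measurableT iu iv.
rewrite /nonlocal_flux -RintegralB//.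
apply: le_trans (le_normr_Rintegral measurableT iuv) _.
have -> : 4 * C * K * e = (\int[mu]_h (k h * (4 * C * e)))%R.
  by rewrite RintegralZr//; ring.
apply: le_ae_Rintegral.
- exact: integrable_norm.
- exact: integrable_mulr.
apply: ae_imply2 er el => h {}er {}el.
rewrite -mulrBr normrM ger0_norm// ler_wpM2l//.
have h1 := gC (u z) (u (z.1 + h, z.2)) (v z) (v (z.1 + h, z.2)).
have h2 := gC (u (z.1 - h, z.2)) (u z) (v (z.1 - h, z.2)) (v z).
have h3 := ler_wpM2l C_ge0 (lerD ez er).
have h4 := ler_wpM2l C_ge0 (lerD el ez).
apply: (@le_trans _ _ (C * (e + e) + C * (e + e))); last by rewrite le_eqVlt; apply/orP; left; apply/eqP; ring.
have E (p q r s : R) : p - q - (r - s) = (p - r) - (q - s) by ring.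
rewrite E; apply: le_trans (ler_normB _ _) _; apply: lerD.
  exact: le_trans h1 h3.
exact: le_trans h2 h4.
Qed.

(** The bound on u - v is first used for almost every time, where it controls the
    values at x, x + h and x - h for almost every x and h, hence the difference of
    the two rates; after exchanging the quantifiers it can be integrated in time
    for almost every x. *)
Lemma exponential_bound_halve (lam b : R) : 8 * C * K <= lam -> 0 < lam -> 0 <= b ->
  {ae (mu \x mu)%E, forall z, strip T z -> `|u z - v z| <= b * expR (lam * z.2)} ->
  {ae (mu \x mu)%E, forall z, strip T z -> `|u z - v z| <= b / 2 * expR (lam * z.2)}.
Proof.
move=> lamC lam0 b0 uv.
have mE (c : R) : measurable_fun setT (fun z : R * R => c * expR (lam * z.2)).
  apply: measurable_funM => //; apply: (measurableT_comp (@measurable_expR R)).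
  by apply: measurable_funM => //; exact: measurable_snd.
have mset (f : R * R -> R) c : measurable_fun setT f ->
    measurable [set z : R * R | strip T z -> f z <= c * expR (lam * z.2)].
  move=> mf; rewrite (_ : mkset _ = ~` (strip T) `|` [set z | f z <= c * expR (lam * z.2)]).
    apply: measurableU; last by by rewrite -[X in measurable X]setTI; apply: measurable_fun_le.
    by apply: measurableC; exact: measurable_strip.
  apply/seteqP; split => z /=.
    by move=> h; have [zT|nT] := pselect (strip T z); [right; exact: h|left].
  by case.
pose F u (z : R * R) := nonlocal_flux k g u z.
have step1 : {ae mu, forall s, {ae mu, forall x, strip T (x, s) ->
    `|F u (x, s) - F v (x, s)| <= 4 * C * K * b * expR (lam * s)}}.
  apply: ae_imply (@ae_prod_ysection _ _ _ _ R mu mu _ uv) => s us.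
  have [sT|sT] := pselect (strip T (0, s)); last first.
    by apply: (ae_imply (P := setT)) => [x _ xT|]; [case: sT|exact: aeW].
  have {}us : {ae mu, forall x, `|u (x, s) - v (x, s)| <= b * expR (lam * s)}.
    by apply: ae_imply us => x; exact.
  apply: ae_imply (us) => x ux _.
  rewrite -[leRHS]mulrA; apply: nonlocal_flux_distance => //=.
  - by apply: ae_imply (ae_translation x us) => h; rewrite (addrC h x).
  - by apply: ae_imply (ae_opp (ae_translation x us)) => h; rewrite (addrC (- h) x).
have mF (f : R * R -> R) : measurable_fun setT f -> measurable_fun setT (F f).
  by move=> mf; exact: (@measurable_nonlocal_flux R k g f ik mg mf).
have step2 : {ae mu, forall x, {ae mu, forall s, strip T (x, s) ->
    `|F u (x, s) - F v (x, s)| <= 4 * C * K * b * expR (lam * s)}}.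
  have mfl : measurable_fun setT (fun z => `|F u z - F v z|).
    by apply: measurableT_comp => //; apply: measurable_funB; exact: mF.
  have := @ae_ysection_prod _ _ _ _ R mu mu _ (mset _ (4 * C * K * b) mfl) step1.
  exact: ae_prod_xsection.
have md : measurable_fun setT (fun z => `|u z - v z|).
  by apply: measurableT_comp => //; exact: measurable_funB.
apply: (@ae_xsection_prod _ _ _ _ R mu mu _ (mset _ (b / 2) md)).
have uUx := @ae_prod_xsection _ _ _ _ R mu mu _ uU.
have vVx := @ae_prod_xsection _ _ _ _ R mu mu _ vV.
have := ae_imply2 (fun x a b => conj a b) uUx vVx.
apply: ae_imply2 step2 => x Fx [ux vx].
apply: ae_imply2 ux vx => t ut vt tT.
rewrite ut// vt//= /integrated_solution /=.
have t0 : 0 < t by case/andP: tT.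
apply: (@le_trans _ _ (4 * C * K * b / lam * expR (lam * t))).
  apply: (@ode_solution_distance R (u0 x) T (flux_bound delta B w) (4 * C * K * b)
    lam t (flux_on_strip T delta w g u x) (flux_on_strip T delta w g v x) lam0 _ t0).
  - by rewrite !mulr_ge0.
  - exact: (measurable_flux_on_strip T w_kernel w_div_h mg mu_).
  - exact: (measurable_flux_on_strip T w_kernel w_div_h mg mv).
  - exact: (flux_on_strip_bound T w_kernel w_div_h mg mu_ uB).
  - exact: (flux_on_strip_bound T w_kernel w_div_h mg mv vB).
  - exact: flux_on_strip_out.
  - exact: flux_on_strip_out.
  - by apply: ae_imply Fx => s Fs sT; rewrite !flux_on_strip_in//; exact: Fs.
rewrite ler_wpM2r ?expR_ge0// ler_pdivrMr//.
have -> : 4 * C * K * b = b / 2 * (8 * C * K) by field.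
by rewrite ler_wpM2l// divr_ge0.
Qed.

(** The initial bound is 2 M, and e^(lam t) >= 1 for t > 0.  Halving it repeatedly
    along a countable family keeps the exceptional sets negligible. *)
Lemma bounded_weak_solution_unique :
  {ae (mu \x mu)%E, forall z, strip T z -> u z = v z}.
Proof.
(* The summand 1 makes lam positive also when C K = 0. *)
pose lam := 8 * C * K + 1.
have lam0 : 0 < lam by rewrite ltr_wpDl// !mulr_ge0.
have M0 : 0 <= M by exact: le_trans (uM (0, 0)).
have un n : {ae (mu \x mu)%E, forall z, strip T z ->
    `|u z - v z| <= (M + M) / 2 ^+ n * expR (lam * z.2)}.
  elim: n => [|n IH].
    apply: aeW => z /andP[z0 _]; rewrite expr0 divr1.
    apply: le_trans (ler_normB _ _) _; apply: (@le_trans _ _ (M + M)); first exact: lerD.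
    by rewrite ler_peMr ?addr_ge0// -expR0 ler_expR mulr_ge0 ?ltW.
  apply: ae_imply (exponential_bound_halve _ lam0 _ IH).
  - by move=> z h /h; rewrite -[_ / 2 ^+ n / 2]mulrA -invfM -exprSr.
  - by rewrite lerDl.
  - by rewrite divr_ge0 ?addr_ge0// exprn_ge0.
apply: ae_imply (ae_foralln un) => z uz zT; apply/eqP; rewrite -subr_eq0 -normr_le0.
have h n : `|u z - v z| <= (M + M) * expR (lam * z.2) * 2^-1 ^+ n.
  by apply: le_trans (uz n zT) _; rewrite exprVn mulrAC.
have c : (M + M) * expR (lam * z.2) * 2^-1 ^+ n @[n --> \oo] --> (M + M) * expR (lam * z.2) * 0.
  apply: cvgM; first exact: cvg_cst.
  by apply: cvg_expr; rewrite ger0_norm ?invr_ge0// invf_lt1 ?ltr1n.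
rewrite mulr0 in c; by apply: (ler_cvg_to (cvg_cst _) c); exact: nearW.
Qed.
End Uniqueness.

(** * Bounded representatives *)

Lemma Lfun_oo_bounded d (X : measurableType d) (R : realType)
    (m : {measure set X -> \bar R}) (f : X -> R) : f \in Lfun m +oo%E ->
  measurable_fun setT f /\ exists M, {ae m, forall x, `|f x| <= M}.
Proof.
rewrite inE => /andP[/set_mem /= mf /set_mem /=]; rewrite /finite_norm unlock.
move=> fM; split => //; move: fM; have [mX|mX _] := ltP 0%E (m setT).
  exact: (ess_supr_bounded (f := fun x => `|f x|)).
by exists 0, setT; split => //; apply/eqP; rewrite eq_le mX measure_ge0.
Qed.

(** Values beyond the essential bound are replaced by 0.  The bound is |M| because
    M may be negative on a null space. *)
Lemma ae_bounded_representative d (X : measurableType d) (R : realType)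
    (m : {measure set X -> \bar R}) (f : X -> R) (M : R) :
  measurable_fun setT f -> {ae m, forall x, `|f x| <= M} ->
  exists f' : X -> R, [/\ measurable_fun setT f', forall x, `|f' x| <= `|M| &
    {ae m, forall x, f x = f' x}].
Proof.
move=> mf fM; exists (fun x => if `|f x| <= M then f x else 0); split.
- apply: measurable_fun_ifT => //; apply: measurable_fun_ler => //.
  exact: measurableT_comp.
- by move=> x; case: ifP => [/le_trans|_]; [apply; exact: ler_norm|rewrite normr0].
- by apply: ae_imply fM => x ->.
Qed.

Section Congruence.
Context {R : realType}.
Local Notation mu := (@lebesgue_measure R).
Variables (T delta : R) (w : R -> R) (F : R -> R -> R) (phi : R * R -> R).
Hypotheses (w_kernel : is_kernel delta w)
  (mF : measurable_fun setT (fun z : R * R => F z.1 z.2))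
  (phiT : test_function T phi).

Definition flux_integral (u : R * R -> R) (z : R * R) : R :=
  (\int[mu]_(h in `[0%R, delta]) ((tau h phi z - phi z) / h * F (u z) (tau h u z) * w h))%R.

Let mshift : measurable_fun setT (fun p : (R * R) * R => (p.1.1 + p.2, p.1.2)).
Proof.
have m11 : measurable_fun setT (fun p : (R * R) * R => p.1.1).
  exact: measurableT_comp measurable_fst measurable_fst.
have m12 : measurable_fun setT (fun p : (R * R) * R => p.1.2).
  exact: measurableT_comp measurable_snd measurable_fst.
have m2 : measurable_fun setT (fun p : (R * R) * R => p.2) by exact: measurable_snd.
by apply: measurable_fun_pair m12; exact: measurable_funD.
Qed.

Let mintegrand (u : R * R -> R) : measurable_fun setT u ->
  measurable_fun setT (fun p : (R * R) * R =>
    (tau p.2 phi p.1 - phi p.1) / p.2 * F (u p.1) (tau p.2 u p.1) * w p.2).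
Proof.
move=> mu_; have [iw _ _ _] := w_kernel.
have mw : measurable_fun setT w by apply/measurable_EFinP; exact: measurable_int iw.
have mphi := continuous2_measurable (test_function_continuous phiT).
apply: measurable_funM; last exact: measurableT_comp mw measurable_snd.
apply: measurable_funM.
  apply: measurable_funM.
    apply: measurable_funB; first exact: measurableT_comp mphi mshift.
    exact: measurableT_comp mphi measurable_fst.
  exact: measurableT_comp (@measurable_inv R) measurable_snd.
apply: (measurableT_comp mF (measurable_fun_pair _ _)).
  exact: measurableT_comp mu_ measurable_fst.
exact: measurableT_comp mu_ mshift.
Qed.

Lemma measurable_flux_integral u : measurable_fun setT u ->
  measurable_fun setT (flux_integral u).
Proof.
move=> mu_; rewrite /flux_integral.
under eq_fun do rewrite Rintegral_mkcond.
pose J (p : (R * R) * R) := ((tau p.2 phi p.1 - phi p.1) / p.2 *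
  F (u p.1) (tau p.2 u p.1) * w p.2) * \1_`[0, delta] p.2.
have mJ : measurable_fun setT J.
  apply: measurable_funM; first exact: mintegrand.
  apply: measurableT_comp measurable_snd; apply: measurable_indic.
  exact: measurable_itv.
have := @measurable_Rintegral_snd _ _ _ _ R mu J mJ.
congr measurable_fun; apply/funext => z; apply: eq_Rintegral => h _.
rewrite patchE /J indicE/=; case: ifP => _; first by rewrite mulr1.
by rewrite mulr0.
Qed.

(** For a point (x, t) at which u and v agree, the values at (x + h, t) agree for
    almost every h, by translation. *)
Lemma ae_eq_flux_integral (u v : R * R -> R) (t : R) :
  measurable_fun setT u -> measurable_fun setT v ->
  {ae mu, forall x, u (x, t) = v (x, t)} ->
  {ae mu, forall x, flux_integral u (x, t) = flux_integral v (x, t)}.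
Proof.
move=> mu_ mv uv.
have mD : measurable (`[0, delta] : set (measurableTypeR R)) by exact: measurable_itv.
have msec (f : R * R -> R) (x : R) : measurable_fun setT f -> measurable_fun `[0, delta] (fun h =>
    (tau h phi (x, t) - phi (x, t)) / h * F (f (x, t)) (tau h f (x, t)) * w h).
  move=> mf; apply: measurable_funTS.
  exact: measurableT_comp (mintegrand mf) (measurable_pair1 (x, t)).
apply: ae_imply (uv) => x uvx.
apply: ae_eq_Rintegral => //; [exact: msec|exact: msec|].
apply: ae_imply (ae_translation x uv) => h; rewrite (addrC h x) => uvh _.
by rewrite /tau /= uvx uvh.
Qed.

(** Almost every time slice of u and v agree almost everywhere in x, so that all
    the inner integrals agree.  Measurability of the inner integrals is needed for
    the integrals in time to depend only on almost everywhere classes. *)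
Lemma weak_form_ae_eq (eta u0 v0 : R -> R) (u v : R * R -> R) :
  measurable_fun setT eta -> measurable_fun setT u0 -> measurable_fun setT v0 ->
  measurable_fun setT u -> measurable_fun setT v ->
  {ae mu, forall x, u0 x = v0 x} ->
  {ae (mu \x mu)%E, forall z, strip T z -> u z = v z} ->
  weak_form T delta w u0 eta F u phi = weak_form T delta w v0 eta F v phi.
Proof.
move=> meta mu0 mv0 mu_ mv uv0 uv.
have mD : measurable (`]0, T[ : set (measurableTypeR R)) by exact: measurable_itv.
have mphi := continuous2_measurable (test_function_continuous phiT).
have mdt := continuous2_measurable (test_function_dt_continuous phiT).
have {}uv : {ae mu, forall t, `]0, T[%classic t ->
    {ae mu, forall x, u (x, t) = v (x, t)}}.
  apply: ae_imply (@ae_prod_ysection _ _ _ _ R mu mu _ uv) => t uvt.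
  by rewrite /= in_itv/= => tT; apply: ae_imply uvt => x; exact.
have mswap (f : R * R -> R) : measurable_fun setT f -> measurable_fun setT (fun z : R * R => f (z.2, z.1) : R).
  move=> mf; apply: (measurableT_comp mf).
  exact: measurable_fun_pair measurable_snd measurable_fst.
have minner (f : R * R -> R) : measurable_fun setT f -> measurable_fun `]0, T[ (fun t => \int[mu]_x f (x, t))%R.
  move=> mf; apply: measurable_funTS.
  exact: (@measurable_Rintegral_snd _ _ _ _ R mu _ (mswap f mf)).
have msec (f : R * R -> R) (t : R) : measurable_fun setT f -> measurable_fun setT (fun x => f (x, t) : R).
  by move=> mf; exact: measurableT_comp mf (measurable_pair2 t).
have meu (f : R * R -> R) : measurable_fun setT f -> measurable_fun setT (fun z => eta (f z) * dt phi z).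
  by move=> mf; apply: measurable_funM mdt; exact: measurableT_comp meta mf.
rewrite /weak_form; apply: (f_equal2 +%R); [apply: (f_equal2 +%R)|].
- apply: (ae_eq_Rintegral mD).
  + exact: (minner _ (meu _ mu_)).
  + exact: (minner _ (meu _ mv)).
  apply: ae_imply uv => t uvt tT; apply: (ae_eq_Rintegral measurableT).
  + exact: (msec _ t (meu _ mu_)).
  + exact: (msec _ t (meu _ mv)).
  by apply: ae_imply (uvt tT) => x ->.
- have m0 (f : R -> R) : measurable_fun setT f -> measurable_fun setT (fun x => eta (f x) * phi (x, 0)).
    by move=> mf; apply: measurable_funM (msec _ 0 mphi); exact: measurableT_comp meta mf.
  apply: (ae_eq_Rintegral measurableT); [exact: m0|exact: m0|].
  by apply: ae_imply uv0 => x ->.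
- have mfu := measurable_flux_integral mu_; have mfv := measurable_flux_integral mv.
  apply: (ae_eq_Rintegral mD); [exact: (minner _ mfu)|exact: (minner _ mfv)|].
  apply: ae_imply uv => t uvt tT; apply: (ae_eq_Rintegral measurableT).
  + exact: (msec _ t mfu).
  + exact: (msec _ t mfv).
  by apply: ae_imply (ae_eq_flux_integral mu_ mv (uvt tT)) => x h _; exact: h.
Qed.

End Congruence.

(** The time integrals run over ]0, T[, and translation in x preserves the strip. *)
Lemma weak_form_strip (R : realType) (T delta : R) (w u0 eta : R -> R)
    (F : R -> R -> R) (u phi : R * R -> R) :
  weak_form T delta w u0 eta F u phi =
  weak_form T delta w u0 eta F (u \_ (strip T)) phi.
Proof.
have uE x t : t \in `]0, T[%classic -> (u \_ (strip T)) (x, t) = u (x, t).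
  by rewrite mem_setE in_itv/= => tT; rewrite patchE mem_set.
rewrite /weak_form; apply: (f_equal2 +%R); [apply: (f_equal2 +%R); [|reflexivity]|].
- by apply: eq_Rintegral => t tT; apply: eq_Rintegral => x _; rewrite uE.
- apply: eq_Rintegral => t tT; apply: eq_Rintegral => x _.
  by apply: eq_Rintegral => h _; rewrite /tau/= !uE.
Qed.

Section Representative.
Context {R : realType}.
Local Notation mu := (@lebesgue_measure R).

(** Only the restriction of u to the strip is assumed measurable and essentially
    bounded; extending it by 0 makes both properties global before truncation. *)
Lemma Linfty_strip_representative (T delta : R) (w u0 v0 : R -> R) (u : R * R -> R) :
  is_kernel delta w -> Linfty u0 -> measurable_fun setT v0 ->
  {ae mu, forall x, u0 x = v0 x} -> Linfty_strip T u ->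
  exists (v : R * R -> R) (M : R), [/\ measurable_fun setT v, forall z, `|v z| <= M,
    {ae (mu \x mu)%E, forall z, strip T z -> u z = v z} &
    forall (eta : R -> R) (F : R -> R -> R) phi, measurable_fun setT eta ->
      measurable_fun setT (fun z : R * R => F z.1 z.2) -> test_function T phi ->
      weak_form T delta w u0 eta F u phi = weak_form T delta w v0 eta F v phi].
Proof.
move=> w_kernel /Lfun_oo_bounded[mu0 _] mv0 uv0 /Lfun_oo_bounded[mus [M usM]].
have [v [mv vM usv]] := ae_bounded_representative mus usM.
have usv' : {ae (mu \x mu)%E, forall z, strip T z -> (u \_ (strip T)) z = v z}.
  by apply: ae_imply usv => z uz _.
exists v, `|M|; split; [exact: mv|exact: vM| |].
  by apply: ae_imply usv' => z + zT => /(_ zT) <-; rewrite patchE mem_set.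
move=> eta F phi meta mF phiT; rewrite weak_form_strip.
exact: (weak_form_ae_eq w_kernel mF phiT meta mu0 mv0 mus mv uv0 usv').
Qed.

End Representative.

(** * Weak solutions are entropy solutions and are unique *)

Theorem theorem2p3 (R : realType) (T delta : R) (u0 w f : R -> R)
    (g : R -> R -> R)
    (T_gt0 : 0 < T) (delta_gt0 : 0 < delta)
    (u0_Linfty : Linfty u0)
    (w_kernel : is_kernel delta w)
    (g_consistent : consistent_flux f g)
    (g_monotone : monotone_flux g)
    (g_lipschitz : lipschitz_flux g)
    (w_div_h : (\int[leb]_(h in `[0%R, delta]) (w h / h)%:E < +oo)%E) :
  (forall u : R * R -> R,
     weak_solution T delta w g u0 u -> entropy_solution T delta w g u0 u) /\
  (forall u v : R * R -> R,
     weak_solution T delta w g u0 u -> weak_solution T delta w g u0 v ->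
     {ae leb2, forall z : R * R, strip T z -> u z = v z}).
Proof.
have mg := lipschitz_flux_measurable g_lipschitz.
have [mu0 [N u0N]] := Lfun_oo_bounded u0_Linfty.
have [v0 [mv0 v0N uv0]] := ae_bounded_representative mu0 u0N.
have rep := Linfty_strip_representative w_kernel u0_Linfty mv0 uv0.
split=> [u [uL uW]|u u' [uL uW] [u'L u'W]].
  split=> // c phi phiT phi0; have [v [M [mv vM uv wf]]] := rep _ _ uL.
  rewrite (wf _ _ _ _ _ phiT).
  - apply: (@bounded_weak_solution_entropy R T delta (`|N| + `|M|) w v0 g v);
      [by []|by []|exact: w_kernel|exact: w_div_h|exact: g_monotone|exact: g_lipschitz|exact: mv| |exact: mv0| | |exact: phiT|exact: phi0].
    + by move=> z; rewrite (le_trans (vM z))// (le_trans (ler_norm M))// lerDr.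
    + by move=> x; rewrite (le_trans (v0N x))// lerDl.
    + by move=> psi psiT; rewrite -(wf _ _ _ (@measurable_id _ _ setT) mg) ?uW.
  - by apply: measurableT_comp => //; exact: measurable_funB.
  - exact: measurable_entropy_flux.
have [v [M [mv vM uv wf]]] := rep _ _ uL.
have [v' [M' [mv' v'M u'v' wf']]] := rep _ _ u'L.
pose L := `|N| + `|M| + `|M'|.
have vL z : `|v z| <= L.
  by rewrite (le_trans (vM z))// (le_trans (ler_norm M))// /L addrAC lerDr.
have v'L z : `|v' z| <= L by rewrite (le_trans (v'M z))// (le_trans (ler_norm M'))// lerDr.
have v0L x : `|v0 x| <= L by rewrite (le_trans (v0N x))// /L -addrA lerDl addr_ge0.
have [B gB] := lipschitz_flux_bound L g_lipschitz.
have [C gC] := g_lipschitz.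
have vB z z' : `|g (v z) (v z')| <= B by exact: gB.
have v'B z z' : `|g (v' z) (v' z')| <= B by exact: gB.
have vW phi : test_function T phi -> weak_form T delta w v0 id g v phi = 0.
  by move=> phiT; rewrite -(wf _ _ _ (@measurable_id _ _ setT) mg) ?uW.
have v'W phi : test_function T phi -> weak_form T delta w v0 id g v' phi = 0.
  by move=> phiT; rewrite -(wf' _ _ _ (@measurable_id _ _ setT) mg) ?u'W.
have vU := weak_solution_integrated T_gt0 delta_gt0 w_kernel w_div_h mg mv vL vB mv0 v0L vW.
have v'U := weak_solution_integrated T_gt0 delta_gt0 w_kernel w_div_h mg mv' v'L v'B mv0 v0L v'W.
have gC' a1 b1 a2 b2 : `|g a1 b1 - g a2 b2| <= `|C| * (`|a1 - a2| + `|b1 - b2|).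
  by apply: le_trans (gC _ _ _ _) _; rewrite ler_wpM2r ?addr_ge0// ler_norm.
have vv' := bounded_weak_solution_unique w_kernel w_div_h mg (normr_ge0 C) gC'
  mv vL vB mv' v'L v'B vU v'U.
have := ae_imply2 (fun z a b => conj a b) uv u'v'.
by apply: ae_imply2 vv' => z vz [uz u'z] zT; rewrite uz// vz// u'z.
Qed.
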